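(* Let $\mathfrak g=\mathrm T^*\mathfrak h_3$ with basis $e_1,\dots,e_6$ and non-zero commutators $[e_1,e_2]=e_6$, $[e_1,e_3]=-e_5$, $[e_2,e_3]=e_4$. The nilsolitons (algebraic Ricci soliton left invariant metrics) on $\mathfrak g$ are (up to isometry): (i) expanding, with $\gamma=-\frac5{2\lambda^2}$, in case of the metric $(S,0,E_{30})$ with $S=\mathrm{diag}(\lambda,\lambda,\lambda)$; (ii) shrinking, with $\gamma=\frac5{2\lambda^2}$, in case of the metric $(S,0,E_{21})$ with $S=\mathrm{diag}(\lambda,\lambda,-\lambda)$; (iii) steady, with $\gamma=0$, in case of the metrics $(S^1,M^2,\pm E_{20})$, $(S^k,M^2,E_{11})$ ($k=1,2,3$), or $(\pm E_{10},M^1,\pm E_{10})$, where $$S^1=\begin{pmatrix}0&0&0\\0&s_{22}&0\\0&0&s_{33}\end{pmatrix},\ S^2=\begin{pmatrix}0&0&0\\0&s_{22}&\frac12|s_{22}|\\0&\frac12|s_{22}|&0\end{pmatrix},\ S^3=\begin{pmatrix}0&0&0\\0&0&\frac12|s_{33}|\\0&\frac12|s_{33}|&s_{33}\end{pmatrix},$$ $$M^1=\begin{pmatrix}0&\lambda&0\\1&0&0\\1&0&0\end{pmatrix},\quad M^2=\begin{pmatrix}1&0&0\\0&0&0\\0&0&0\end{pmatrix}.$$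
   Context: A left invariant metric is identified with a non-degenerate symmetric bilinear form on $\mathfrak g$. The triple $(S,M,E)$ denotes the metric with Gram matrix $\begin{pmatrix}S&M\\ M^T&E\end{pmatrix}$ in the basis $e$; parameters are real and such that it is non-degenerate (so $\lambda\neq0$, $s_{22}\ne0$, $s_{33}\ne0$). Notation: $E_{30}=I$, $E_{21}=\mathrm{diag}(1,1,-1)$, $E_{20}=\mathrm{diag}(0,1,1)$, $E_{11}=\mathrm{diag}(0,1,-1)$, $E_{10}=\mathrm{diag}(0,0,1)$. A left invariant metric is an algebraic Ricci soliton if its Ricci operator satisfies $\mathrm{Ric}=\gamma I+D$ with $\gamma\in\mathbb R$ and $D$ a derivation of the Lie algebra; it is shrinking, steady or expanding according to $\gamma>0$, $\gamma=0$ or $\gamma<0$. Two left invariant metrics on $\mathfrak g$ are isometric iff they are related by an automorphism of $\mathfrak g$.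
   Formalization: The printed list is incomplete; the theorem adds the missing nilsolitons: (diag(λ,λ,λ),0,−E30), (diag(λ,λ,−λ),0,−E21), one more S (block a,b;b,−a) with M², E11, two further steady types with ±E10, and (0,M,0) with M invertible, and proves this enlarged list complete. *)

(* Defs.v *)
From mathcomp Require Import all_boot all_order all_algebra.
From mathcomp Require Import reals.

Set Implicit Arguments.
Unset Strict Implicit.
Unset Printing Implicit Defensive.

Import Order.TTheory GRing.Theory Num.Theory.
Local Open Scope ring_scope.

Section CotangentHeisenberg.
Variable R : realType.

(* Elements of the Lie algebra are coordinate columns in the basis e_1 .. e_6,
   endomorphisms are matrices acting on the left, bilinear forms are Gram
   matrices. The index k of [e k] and [coord x k] runs from 1 to 6. *)
Notation alg := 'cV[R]_6.

Definition e (k : nat) : alg := delta_mx (inord k.-1) 0.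
Definition coord (x : alg) (k : nat) : R := x (inord k.-1) 0.

Definition bracket (x y : alg) : alg :=
  (coord x 1 * coord y 2 - coord x 2 * coord y 1) *: e 6
  - (coord x 1 * coord y 3 - coord x 3 * coord y 1) *: e 5
  + (coord x 2 * coord y 3 - coord x 3 * coord y 2) *: e 4.

Definition derivation (D : 'M[R]_6) : Prop :=
  forall x y : alg,
    D *m bracket x y = bracket (D *m x) y + bracket x (D *m y).

Definition automorphism (A : 'M[R]_6) : Prop :=
  A \in unitmx /\
  forall x y : alg, A *m bracket x y = bracket (A *m x) (A *m y).

Definition is_metric (g : 'M[R]_6) : Prop := g^T = g /\ g \in unitmx.

(* For left invariant metrics on this algebra, isometric means related by an
   automorphism of the algebra. *)
Definition isometric (g h : 'M[R]_6) : Prop :=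
  exists2 A : 'M[R]_6, automorphism A & g = A^T *m h *m A.

Definition inner (g : 'M[R]_6) (x y : alg) : R := (x^T *m g *m y) 0 0.

(* Koszul formula for left invariant fields:
   2 g(nabla_x y, z) = g([x,y],z) - g([y,z],x) + g([z,x],y). *)
Definition koszul (g : 'M[R]_6) (x y z : alg) : R :=
  inner g (bracket x y) z - inner g (bracket y z) x + inner g (bracket z x) y.

Definition nabla (g : 'M[R]_6) (x y : alg) : alg :=
  invmx g *m (\col_k (koszul g x y (delta_mx k 0) / 2)).

Definition curvature (g : 'M[R]_6) (x y z : alg) : alg :=
  nabla g x (nabla g y z) - nabla g y (nabla g x z) - nabla g (bracket x y) z.

(* ric(x,y) is the trace of z |-> R(z,x)y. *)
Definition ricci_tensor (g : 'M[R]_6) (x y : alg) : R :=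
  \sum_k curvature g (delta_mx k 0) x y k 0.

(* g(Ric x, y) = ric(x,y). *)
Definition ricci_operator (g : 'M[R]_6) : 'M[R]_6 :=
  invmx g *m \matrix_(i, j) ricci_tensor g (delta_mx j 0) (delta_mx i 0).

Definition nilsoliton (g : 'M[R]_6) (gamma : R) : Prop :=
  is_metric g /\
  exists2 D : 'M[R]_6, derivation D & ricci_operator g = gamma%:M + D.

Definition expanding (g : 'M[R]_6) (gamma : R) : Prop :=
  nilsoliton g gamma /\ gamma < 0.
Definition shrinking (g : 'M[R]_6) (gamma : R) : Prop :=
  nilsoliton g gamma /\ 0 < gamma.
Definition steady (g : 'M[R]_6) (gamma : R) : Prop :=
  nilsoliton g gamma /\ gamma = 0.

Definition metric (S M E : 'M[R]_3) : 'M[R]_6 := block_mx S M M^T E.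

Definition mx3 (rows : seq (seq R)) : 'M[R]_3 :=
  \matrix_(i, j) (nth [::] rows i)`_j.
Definition diag3 (a b c : R) : 'M[R]_3 :=
  mx3 [:: [:: a; 0; 0]; [:: 0; b; 0]; [:: 0; 0; c]].

Definition E30 : 'M[R]_3 := diag3 1 1 1.
Definition E21 : 'M[R]_3 := diag3 1 1 (-1).
Definition E20 : 'M[R]_3 := diag3 0 1 1.
Definition E11 : 'M[R]_3 := diag3 0 1 (-1).
Definition E10 : 'M[R]_3 := diag3 0 0 1.

Definition S1 (s22 s33 : R) : 'M[R]_3 := diag3 0 s22 s33.
Definition S2 (s22 : R) : 'M[R]_3 :=
  mx3 [:: [:: 0; 0; 0]; [:: 0; s22; `|s22| / 2]; [:: 0; `|s22| / 2; 0]].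
Definition S3 (s33 : R) : 'M[R]_3 :=
  mx3 [:: [:: 0; 0; 0]; [:: 0; 0; `|s33| / 2]; [:: 0; `|s33| / 2; s33]].
Definition M1 (l : R) : 'M[R]_3 :=
  mx3 [:: [:: 0; l; 0]; [:: 1; 0; 0]; [:: 1; 0; 0]].
Definition M2 : 'M[R]_3 := diag3 1 0 0.

Inductive family_i : 'M[R]_6 -> R -> Prop :=
| Family_i (l : R) : l != 0 ->
    family_i (metric (diag3 l l l) 0 E30) (- (5 / (2 * l ^+ 2))).

Inductive family_ii : 'M[R]_6 -> R -> Prop :=
| Family_ii (l : R) : l != 0 ->
    family_ii (metric (diag3 l l (- l)) 0 E21) (5 / (2 * l ^+ 2)).

(* The signs +- are powers of -1 with a boolean exponent; in the last family
   the two signs are independent. *)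
Inductive family_iii : 'M[R]_6 -> R -> Prop :=
| Family_iii_20 (b : bool) (s22 s33 : R) : s22 != 0 -> s33 != 0 ->
    family_iii (metric (S1 s22 s33) M2 ((-1) ^+ b *: E20)) 0
| Family_iii_11_1 (s22 s33 : R) : s22 != 0 -> s33 != 0 ->
    family_iii (metric (S1 s22 s33) M2 E11) 0
| Family_iii_11_2 (s22 : R) : s22 != 0 ->
    family_iii (metric (S2 s22) M2 E11) 0
| Family_iii_11_3 (s33 : R) : s33 != 0 ->
    family_iii (metric (S3 s33) M2 E11) 0
| Family_iii_10 (b c : bool) (l : R) : l != 0 ->
    family_iii (metric ((-1) ^+ b *: E10) (M1 l) ((-1) ^+ c *: E10)) 0.

(* Families (i)-(iii) do not exhaust the nilsolitons. The normal forms below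
   are also nilsolitons, and none is isometric to a member of (i)-(iii):
   - the centre <e_4,e_5,e_6> is preserved by automorphisms, so the signature
     of the block E is an invariant; -E30, -E21 and E = 0 do not occur there;
   - Omitted_11: on <e_2,e_3>, E11^-1 S has non-real eigenvalues;
   - Omitted_10 (D <> 0) and Omitted_10_flat (Ricci-flat): rank E = 1, with the
     other relative positions of the pairing M and the kernel of E. *)
Inductive omitted_family : 'M[R]_6 -> R -> Prop :=
| Omitted_30 (l : R) : l != 0 ->
    omitted_family (metric (diag3 l l l) 0 (- E30)) (5 / (2 * l ^+ 2))
| Omitted_21 (l : R) : l != 0 ->
    omitted_family (metric (diag3 l l (- l)) 0 (- E21)) (- (5 / (2 * l ^+ 2)))
| Omitted_11 (a b : R) : b != 0 ->
    omitted_family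
      (metric (mx3 [:: [:: 0; 0; 0]; [:: 0; a; b]; [:: 0; b; - a]]) M2 E11) 0
| Omitted_10 (b c : bool) (l : R) : l != 0 ->
    omitted_family
      (metric ((-1) ^+ b *: diag3 0 1 0)
         (mx3 [:: [:: 1; 0; 0]; [:: 0; 0; 0]; [:: 0; l; 0]])
         ((-1) ^+ c *: E10)) 0
| Omitted_10_flat (b c : bool) (p q r s : R) : p * s - q * r != 0 ->
    omitted_family
      (metric ((-1) ^+ b *: E10)
         (mx3 [:: [:: p; q; 0]; [:: r; s; 0]; [:: 0; 0; 0]])
         ((-1) ^+ c *: E10)) 0
| Omitted_00 (M : 'M[R]_3) : M \in unitmx ->
    omitted_family (metric 0 M 0) 0.

End CotangentHeisenberg.

(* Main.v *)
Require Import Defs.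
From mathcomp Require Import all_boot all_order all_algebra.
From mathcomp Require Import reals ring lra.

(** Write a metric as [g = [[S, M], [M^T, E]]] and its inverse as
    [[[P, Q], [Q^T, T]]]. The bracket is the cross product of the generator parts,
    with values in the centre, so automorphisms have diagonal blocks [B] and
    [cof B], and derivations have diagonal blocks [X] and [tr X - X^T]. The Koszul
    formula gives a block triangular Ricci operator with diagonal blocks
    [- P (P # E) / 2] and [cof P E / 2], where [P # E] is the linearised cofactor.
    Since [(P # E) P + cof P E = tr (cof P E)], the soliton equation collapses to
    [cof P E = c] with [c] a scalar and [gamma = - 5 c / 2].

    If [c <> 0], shearing [M] away leaves [S] proportional to [E^-1]. If [c = 0],
    then [E] is singular: for rank 2 the equation says that the remaining column of
    [M] is the kernel direction of [E], and what is left is a pair of binary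
    quadratic forms; for rank at most 1 the equation is automatic, and only the
    position of the common annihilator of the columns of [M] matters. *)

Set Implicit Arguments.
Unset Strict Implicit.
Unset Printing Implicit Defensive.

Import Order.TTheory GRing.Theory Num.Theory.
Local Open Scope ring_scope.

(** * Cross products and cofactors of 3x3 matrices *)

Section ThreeByThree.
Variable R : realType.
Implicit Types (A B P Q E K : 'M[R]_3) (u v w : 'cV[R]_3).

(** The bracket sees only generator parts and takes values in the centre, so every connection matrix
    factors through 3x3 matrices. The relations [U W = 0], [U L = P], [N W = E], [N L = 0] then turn
    each trace over the algebra into a trace of 3x3 products, and curvature is never expanded in
    coordinates.

    An automorphism conjugates [cof P E] by its action on the centre, so the equation [cof P E = c]
    can be used afresh after each normalisation. The order [E], [M], [S] is forced: writing [C] for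
    the free block from generators to centre, [E] changes through [B] alone, [M] also through
    [C^T E], and [S] also through [M C] and its transpose. When [E] is singular, [C^T E] cannot
    remove all of [M], but what remains of [M] lets [C] clear most of [S]. Degenerate parameters are
    excluded by exhibiting a vector in the kernel of the metric. *)

Definition cv3 (a b c : R) : 'cV[R]_3 := \col_i [:: a; b; c]`_i.

Lemma ord3P (i : 'I_3) :
  [\/ i = inord 0, i = inord 1 | i = inord 2].
Proof.
case: i => [[|[|[|//]]] H]; [constructor 1|constructor 2|constructor 3];
  by apply/val_inj; rewrite /= inordK.
Qed.

Lemma sum3 (V : nmodType) (F : 'I_3 -> V) :
  \sum_i F i = F (inord 0) + F (inord 1) + F (inord 2).
Proof.
rewrite !big_ord_recl big_ord0 addr0 addrA.
by congr (F _ + F _ + F _); apply/val_inj; rewrite /= ?inordK.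
Qed.

Lemma mx3_eta A : A = mx3
  [:: [:: A (inord 0) (inord 0); A (inord 0) (inord 1); A (inord 0) (inord 2)];
      [:: A (inord 1) (inord 0); A (inord 1) (inord 1); A (inord 1) (inord 2)];
      [:: A (inord 2) (inord 0); A (inord 2) (inord 1); A (inord 2) (inord 2)]].
Proof.
by apply/matrixP => i j; rewrite mxE;
  case: (ord3P i) => ->; case: (ord3P j) => ->; rewrite !inordK.
Qed.

Lemma mx3P A : exists a b c d e f g h i,
  A = mx3 [:: [:: a; b; c]; [:: d; e; f]; [:: g; h; i]].
Proof. by do 9![eexists]; exact: mx3_eta. Qed.

Lemma mx3_inj (a b c d e f g h i a' b' c' d' e' f' g' h' i' : R) :
  mx3 [:: [:: a; b; c]; [:: d; e; f]; [:: g; h; i]] =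
  mx3 [:: [:: a'; b'; c']; [:: d'; e'; f']; [:: g'; h'; i']] ->
  [/\ [/\ a = a', b = b' & c = c'], [/\ d = d', e = e' & f = f']
    & [/\ g = g', h = h' & i = i']].
Proof.
move=> /matrixP H; split; split;
 [move: (H (inord 0) (inord 0))|move: (H (inord 0) (inord 1))
 |move: (H (inord 0) (inord 2))|move: (H (inord 1) (inord 0))
 |move: (H (inord 1) (inord 1))|move: (H (inord 1) (inord 2))
 |move: (H (inord 2) (inord 0))|move: (H (inord 2) (inord 1))
 |move: (H (inord 2) (inord 2))]; by rewrite !mxE !inordK.
Qed.

Lemma trmx3 (a b c d e f g h i : R) :
  (mx3 [:: [:: a; b; c]; [:: d; e; f]; [:: g; h; i]])^T =
  mx3 [:: [:: a; d; g]; [:: b; e; h]; [:: c; f; i]].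
Proof.
by apply/matrixP => x y; rewrite !mxE;
  case: (ord3P x) => ->; case: (ord3P y) => ->; rewrite !inordK.
Qed.

Lemma sym3P A : A^T = A -> exists a b c d e f,
  A = mx3 [:: [:: a; b; c]; [:: b; d; e]; [:: c; e; f]].
Proof.
have [a [b [c [d [e [f [g [h [i ->]]]]]]]]] := mx3P A.
rewrite trmx3 => /mx3_inj[[_ -> ->] [_ _ ->] _].
by do 6![eexists].
Qed.

Lemma mulmx3 (a b c d e f g h i a' b' c' d' e' f' g' h' i' : R) :
  mx3 [:: [:: a; b; c]; [:: d; e; f]; [:: g; h; i]] *m
  mx3 [:: [:: a'; b'; c']; [:: d'; e'; f']; [:: g'; h'; i']] =
  mx3 [:: [:: a * a' + b * d' + c * g'; a * b' + b * e' + c * h';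
              a * c' + b * f' + c * i'];
          [:: d * a' + e * d' + f * g'; d * b' + e * e' + f * h';
              d * c' + e * f' + f * i'];
          [:: g * a' + h * d' + i * g'; g * b' + h * e' + i * h';
              g * c' + h * f' + i * i']].
Proof.
by apply/matrixP => x y; rewrite !mxE sum3 !mxE;
  case: (ord3P x) => ->; case: (ord3P y) => ->; rewrite !inordK.
Qed.

Lemma addmx3 (a b c d e f g h i a' b' c' d' e' f' g' h' i' : R) :
  mx3 [:: [:: a; b; c]; [:: d; e; f]; [:: g; h; i]] +
  mx3 [:: [:: a'; b'; c']; [:: d'; e'; f']; [:: g'; h'; i']] =
  mx3 [:: [:: a + a'; b + b'; c + c']; [:: d + d'; e + e'; f + f'];
          [:: g + g'; h + h'; i + i']].
Proof.
by apply/matrixP => x y; rewrite !mxE;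
  case: (ord3P x) => ->; case: (ord3P y) => ->; rewrite !inordK.
Qed.

Lemma scalemx3 (k a b c d e f g h i : R) :
  k *: mx3 [:: [:: a; b; c]; [:: d; e; f]; [:: g; h; i]] =
  mx3 [:: [:: k * a; k * b; k * c]; [:: k * d; k * e; k * f];
          [:: k * g; k * h; k * i]].
Proof.
by apply/matrixP => x y; rewrite !mxE;
  case: (ord3P x) => ->; case: (ord3P y) => ->; rewrite !inordK.
Qed.

Lemma oppmx3 (a b c d e f g h i : R) :
  - mx3 [:: [:: a; b; c]; [:: d; e; f]; [:: g; h; i]] =
  mx3 [:: [:: - a; - b; - c]; [:: - d; - e; - f]; [:: - g; - h; - i]].
Proof.
by apply/matrixP => x y; rewrite !mxE;
  case: (ord3P x) => ->; case: (ord3P y) => ->; rewrite !inordK.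
Qed.

Lemma scalar_mx3 (k : R) : k%:M = diag3 k k k.
Proof.
apply/matrixP => x y; rewrite !mxE.
by case: (ord3P x) => ->; case: (ord3P y) => ->; rewrite -val_eqE /= !inordK.
Qed.

Lemma const_mx3 : (0 : 'M[R]_3) = diag3 0 0 0.
Proof.
apply/matrixP => x y; rewrite !mxE.
by case: (ord3P x) => ->; case: (ord3P y) => ->; rewrite !inordK.
Qed.

Lemma mxtrace3 (a b c d e f g h i : R) :
  \tr (mx3 [:: [:: a; b; c]; [:: d; e; f]; [:: g; h; i]]) = a + e + i.
Proof. by rewrite /mxtrace sum3 !mxE !inordK. Qed.

Definition mx3_simpl :=
  (trmx3, mulmx3, addmx3, scalemx3, oppmx3, mxtrace3, scalar_mx3, const_mx3).

Lemma cv3P v : exists a b c, v = cv3 a b c.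
Proof.
exists (v (inord 0) 0), (v (inord 1) 0), (v (inord 2) 0).
by apply/matrixP => i j; rewrite ord1 mxE; case: (ord3P i) => ->; rewrite !inordK.
Qed.

Lemma cv3_inj (a b c a' b' c' : R) :
  cv3 a b c = cv3 a' b' c' -> [/\ a = a', b = b' & c = c'].
Proof.
move=> /matrixP H; split; [move: (H (inord 0) 0)|move: (H (inord 1) 0)
  |move: (H (inord 2) 0)]; by rewrite !mxE !inordK.
Qed.

Lemma mulmx3_cv (a b c d e f g h i x y z : R) :
  mx3 [:: [:: a; b; c]; [:: d; e; f]; [:: g; h; i]] *m cv3 x y z =
  cv3 (a * x + b * y + c * z) (d * x + e * y + f * z) (g * x + h * y + i * z).
Proof.
by apply/matrixP => k j; rewrite !mxE sum3 !mxE;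
  case: (ord3P k) => ->; rewrite !inordK.
Qed.

Lemma add_cv3 (a b c a' b' c' : R) :
  cv3 a b c + cv3 a' b' c' = cv3 (a + a') (b + b') (c + c').
Proof.
by apply/matrixP => k j; rewrite !mxE; case: (ord3P k) => ->; rewrite !inordK.
Qed.

Lemma opp_cv3 (a b c : R) : - cv3 a b c = cv3 (- a) (- b) (- c).
Proof.
by apply/matrixP => k j; rewrite !mxE; case: (ord3P k) => ->; rewrite !inordK.
Qed.

Lemma cv30 : (0 : 'cV[R]_3) = cv3 0 0 0.
Proof.
by apply/matrixP => k j; rewrite !mxE; case: (ord3P k) => ->; rewrite !inordK.
Qed.

Lemma dot_cv3 (a b c a' b' c' : R) :
  ((cv3 a b c)^T *m cv3 a' b' c') 0 0 = a * a' + b * b' + c * c'.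
Proof. by rewrite !mxE sum3 !mxE !inordK. Qed.

(* [crossmx] and [cof3] are locked so that rewriting with [mulmx3] and [mulmx3_cv]
   does not unfold them. *)
Definition crossmx v : 'M[R]_3 :=
  let x := v (inord 0) 0 in let y := v (inord 1) 0 in let z := v (inord 2) 0 in
  locked (mx3 [:: [:: 0; - z; y]; [:: z; 0; - x]; [:: - y; x; 0]]).

Lemma crossmx_cv3 (x y z : R) : crossmx (cv3 x y z) =
  mx3 [:: [:: 0; - z; y]; [:: z; 0; - x]; [:: - y; x; 0]].
Proof. by rewrite /crossmx -lock !mxE !inordK. Qed.

Definition cof3 A : 'M[R]_3 :=
  let x := inord 0 in let y := inord 1 in let z := inord 2 in
  locked (mx3 [:: [:: A y y * A z z - A y z * A z y; A y z * A z x - A y x * A z z;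
              A y x * A z y - A y y * A z x];
          [:: A z y * A x z - A z z * A x y; A z z * A x x - A z x * A x z;
              A z x * A x y - A z y * A x x];
          [:: A x y * A y z - A x z * A y y; A x z * A y x - A x x * A y z;
              A x x * A y y - A x y * A y x]]).

Lemma cof3E (a b c d e f g h i : R) :
  cof3 (mx3 [:: [:: a; b; c]; [:: d; e; f]; [:: g; h; i]]) =
  mx3 [:: [:: e * i - f * h; f * g - d * i; d * h - e * g];
          [:: h * c - i * b; i * a - g * c; g * b - h * a];
          [:: b * f - c * e; c * d - a * f; a * e - b * d]].
Proof. by rewrite /cof3 -lock !mxE !inordK. Qed.

(** Since [cof3] is quadratic, this is exactly the bilinear map with [polar P P = 2 cof3 P], not
    merely a first-order term. *)
Definition polar P E : 'M[R]_3 := cof3 (P + E) - cof3 P - cof3 E.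

Lemma mx3_eq (a b c d e f g h i a' b' c' d' e' f' g' h' i' : R) :
  a = a' -> b = b' -> c = c' -> d = d' -> e = e' -> f = f' ->
  g = g' -> h = h' -> i = i' ->
  mx3 [:: [:: a; b; c]; [:: d; e; f]; [:: g; h; i]] =
  mx3 [:: [:: a'; b'; c']; [:: d'; e'; f']; [:: g'; h'; i']].
Proof. by do 9![move=> ->]. Qed.

End ThreeByThree.

Ltac mx3_ring := rewrite /diag3 ?(cof3E, mx3_simpl); apply: mx3_eq; ring.
Ltac mx3_field := rewrite /diag3 ?(cof3E, mx3_simpl); apply: mx3_eq; field.

Section CrossProduct.
Variable R : realType.
Implicit Types (A B P E : 'M[R]_3) (u v : 'cV[R]_3).

Lemma tr_crossmx_sym v P : P^T = P -> \tr (crossmx v *m P) = 0.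
Proof.
move=> /sym3P[a [b [c [d [e [f ->]]]]]]; have [x [y [z ->]]] := cv3P v.
rewrite crossmx_cv3 !mx3_simpl; ring.
Qed.

Lemma tr_crossmx u : (crossmx u)^T = - crossmx u.
Proof.
have [x [y [z ->]]] := cv3P u.
rewrite !crossmx_cv3 !mx3_simpl; apply: mx3_eq; ring.
Qed.

Lemma crossmxC u v : crossmx u *m v = - (crossmx v *m u).
Proof.
have [x [y [z ->]]] := cv3P u; have [x' [y' [z' ->]]] := cv3P v.
rewrite !crossmx_cv3 !mulmx3_cv opp_cv3; congr cv3; ring.
Qed.

(** For symmetric [P], [P [v] P] is the cross product matrix of [cof3 P *m v], and [\tr ([a] [b])]
    is -2 times the dot product of [a] and [b]. *)
Lemma tr_crossmx_cof u v P : P^T = P ->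
  \tr (crossmx u *m P *m crossmx v *m P) = - 2 * (v^T *m (cof3 P *m u)) 0 0.
Proof.
move=> /sym3P[a [b [c [d [e [f ->]]]]]].
have [x [y [z ->]]] := cv3P u; have [x' [y' [z' ->]]] := cv3P v.
rewrite !crossmx_cv3 cof3E !mulmx3_cv dot_cv3 !mx3_simpl; ring.
Qed.

(** Polarisation of the previous identity: [P [u] E + E [u] P] is the cross product matrix of
    [polar P E *m u], and by transposition both summands have the same trace against [[v]]. *)
Lemma tr_crossmx_polar u v P E : P^T = P -> E^T = E ->
  \tr (crossmx v *m E *m crossmx u *m P) = - (v^T *m (polar P E *m u)) 0 0.
Proof.
move=> /sym3P[a [b [c [d [e [f ->]]]]]] /sym3P[a' [b' [c' [d' [e' [f' ->]]]]]].
have [x [y [z ->]]] := cv3P u; have [x' [y' [z' ->]]] := cv3P v.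
rewrite /polar addmx3 !crossmx_cv3 !cof3E !oppmx3 !addmx3 !mulmx3_cv dot_cv3 !mx3_simpl.
ring.
Qed.

(* The derivative of [cof3 P *m P = (\det P)%:M] in the direction [E]. *)
Lemma polar_mul P E : P^T = P -> E^T = E ->
  polar P E *m P + cof3 P *m E = (\tr (cof3 P *m E))%:M.
Proof.
move=> /sym3P[a [b [c [d [e [f ->]]]]]] /sym3P[a' [b' [c' [d' [e' [f' ->]]]]]].
rewrite /polar addmx3; mx3_ring.
Qed.

Lemma cof3_tr A : cof3 A^T = (cof3 A)^T.
Proof.
have [a [b [c [d [e [f [g [h [i ->]]]]]]]]] := mx3P A; mx3_ring.
Qed.

Lemma cof3M A B : cof3 (A *m B) = cof3 A *m cof3 B.
Proof.
have [a [b [c [d [e [f [g [h [i ->]]]]]]]]] := mx3P A.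
have [a' [b' [c' [d' [e' [f' [g' [h' [i' ->]]]]]]]]] := mx3P B; mx3_ring.
Qed.

Lemma cof3_1 : cof3 1%:M = 1%:M :> 'M[R]_3.
Proof. mx3_ring. Qed.

Lemma cof3Z k A : cof3 (k *: A) = k ^+ 2 *: cof3 A.
Proof.
have [a [b [c [d [e [f [g [h [i ->]]]]]]]]] := mx3P A; mx3_ring.
Qed.

Lemma det_mx3 (a b c d e f g h i : R) :
  \det (mx3 [:: [:: a; b; c]; [:: d; e; f]; [:: g; h; i]]) =
  a * (e * i - f * h) + b * (f * g - d * i) + c * (d * h - e * g).
Proof.
rewrite (expand_det_row _ 0) !big_ord_recl big_ord0 /cofactor.
rewrite !(expand_det_row _ 0) !big_ord_recl !big_ord0 /cofactor !det_mx11 !mxE /=.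
rewrite /bump /=; ring.
Qed.

Lemma cof3_cof3 A : cof3 (cof3 A) = \det A *: A.
Proof.
have [a [b [c [d [e [f [g [h [i ->]]]]]]]]] := mx3P A.
rewrite det_mx3; mx3_ring.
Qed.

Lemma cof3_unit A : A \in unitmx -> cof3 A \in unitmx.
Proof.
move=> uA; apply: (proj1 (@mulmx1_unit _ _ _ (cof3 (invmx A)) _)).
by rewrite -cof3M mulmxV // cof3_1.
Qed.

Lemma cof3_crossmx A u v : crossmx (A *m u) *m (A *m v) = cof3 A *m (crossmx u *m v).
Proof.
have [a [b [c [d [e [f [g [h [i ->]]]]]]]]] := mx3P A.
have [x [y [z ->]]] := cv3P u; have [x' [y' [z' ->]]] := cv3P v.
rewrite cof3E !mulmx3_cv !crossmx_cv3 !mulmx3_cv; congr cv3; ring.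
Qed.

(** The derivative of [cof3_crossmx] at the identity: [cof3] has differential [\tr A - A^T]
    there. *)
Lemma crossmx_deriv A u v :
  crossmx (A *m u) *m v + crossmx u *m (A *m v) =
  ((\tr A)%:M - A^T) *m (crossmx u *m v).
Proof.
have [a [b [c [d [e [f [g [h [i ->]]]]]]]]] := mx3P A.
have [x [y [z ->]]] := cv3P u; have [x' [y' [z' ->]]] := cv3P v.
rewrite !mx3_simpl !mulmx3_cv !crossmx_cv3 !mulmx3_cv add_cv3; congr cv3; ring.
Qed.

(** Each basis vector is a cross product of two others; in the algebra, the brackets fill the whole
    centre. *)
Lemma crossmx_span A B :
  (forall u v, A *m (crossmx u *m v) = B *m (crossmx u *m v)) -> A = B.
Proof.
have [a [b [c [d [e [f [g [h [i ->]]]]]]]]] := mx3P A.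
have [a' [b' [c' [d' [e' [f' [g' [h' [i' ->]]]]]]]]] := mx3P B.
move=> H.
have := H (cv3 0 1 0) (cv3 0 0 1); have := H (cv3 0 0 1) (cv3 1 0 0).
have := H (cv3 1 0 0) (cv3 0 1 0).
rewrite !crossmx_cv3 !mulmx3_cv => /cv3_inj[h1 h2 h3] /cv3_inj[h4 h5 h6]
  /cv3_inj[h7 h8 h9].
by apply: mx3_eq; lra.
Qed.

End CrossProduct.

(** * The Ricci operator *)

Section Ricci.
Variable R : realType.

Definition proj_gen : 'M[R]_(3, 6) := row_mx 1%:M (0 : 'M_3).
Definition inj_ctr : 'M[R]_(6, 3) := col_mx (0 : 'M_3) 1%:M.

Local Notation U := proj_gen.
Local Notation W := inj_ctr.

Lemma proj_genE (x : 'cV[R]_6) : U *m x = usubmx (x : 'cV_(3 + 3)).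
Proof.
by rewrite -{1}(vsubmxK (x : 'cV_(3 + 3))) (@mul_row_col _ _ 3 3) mul1mx mul0mx addr0.
Qed.

Lemma inj_ctrE (v : 'cV[R]_3) : W *m v = col_mx (0 : 'cV_3) v.
Proof. by rewrite (@mul_col_mx _ 3 3) mul0mx mul1mx. Qed.

Lemma bracketE (x y : 'cV[R]_6) : bracket x y = W *m (crossmx (U *m x) *m (U *m y)).
Proof.
rewrite !proj_genE inj_ctrE.
have [a [b [c ux]]] := cv3P (usubmx (x : 'cV_(3 + 3))).
have [a' [b' [c' uy]]] := cv3P (usubmx (y : 'cV_(3 + 3))).
rewrite ux uy.
have cE (z : 'cV[R]_6) k : (k < 3)%N -> z (inord k) 0 = usubmx (z : 'cV_(3 + 3)) (inord k) 0.
  by move=> k3; rewrite mxE; congr (z _ _); apply/val_inj; rewrite /= !inordK // (leq_trans k3).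
rewrite /bracket /Defs.coord /Defs.e /= !cE // ux uy !mxE !inordK //= crossmx_cv3 mulmx3_cv.
apply/matrixP => i j; rewrite ord1 !mxE eqxx !andbT.
case: splitP => k ik.
  rewrite mxE; have: (i < 3)%N by rewrite ik.
  by case: i {ik} => [[|[|[|//]]] hi] _; rewrite -!val_eqE /= !inordK //= !mulr0 subrr addr0.
rewrite mxE -!val_eqE /= !inordK // ik.
by case: (ord3P k) => ->; rewrite !inordK //=; ring.
Qed.

Lemma proj_inj_ctr : U *m W = 0.
Proof. by rewrite (@mul_row_col _ _ 3 3) mul0mx mulmx0 addr0. Qed.

(** Cyclic invariance of the scalar triple product. It isolates the third argument of the Koszul
    formula, so that [nabla] can be read off. *)
Lemma triple_product (a b c na nb : 'cV[R]_3) :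
  - ((crossmx b *m c)^T *m na) 0 0 + ((crossmx c *m a)^T *m nb) 0 0 =
  - ((crossmx na *m b - crossmx a *m nb)^T *m c) 0 0.
Proof.
have [x [y [z ->]]] := cv3P a; have [x' [y' [z' ->]]] := cv3P b.
have [x'' [y'' [z'' ->]]] := cv3P c; have [p [q [r ->]]] := cv3P na.
have [p' [q' [r' ->]]] := cv3P nb.
rewrite !crossmx_cv3 !mulmx3_cv opp_cv3 add_cv3 !dot_cv3; ring.
Qed.

(* [N x] stands for the restriction of [g(x, -)] to the centre and [L] for the first three
   columns of [g^-1]. Then [connection x] is [y |-> nabla_x y] and [connection_r y] is
   [x |-> nabla_x y], both expressed by cross products. *)
Section Connection.
Variables (N : 'M[R]_(3, 6)) (L : 'M[R]_(6, 3)) (P E : 'M[R]_3).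
Hypotheses (PT : P^T = P) (ET : E^T = E).
Hypotheses (proj_dual_block : U *m L = P) (ctr_form_inj_ctr : N *m W = E) (ctr_form_gen_dual : N *m L = 0).

Definition connection (x : 'cV[R]_6) : 'M[R]_6 :=
  2^-1 *: (W *m crossmx (U *m x) *m U
           - L *m (crossmx (N *m x) *m U - crossmx (U *m x) *m N)).

Definition connection_r (y : 'cV[R]_6) : 'M[R]_6 :=
  2^-1 *: (L *m (crossmx (U *m y) *m N - crossmx (N *m y) *m U)
           - W *m crossmx (U *m y) *m U).

Lemma connection_rE x y : connection x *m y = connection_r y *m x.
Proof.
rewrite /connection /connection_r -!scalemxAl; congr (_ *: _).
rewrite !mulmxBl -!mulmxA !mulmxBl -!mulmxA.
rewrite [crossmx (U *m x) *m (U *m y)]crossmxC [crossmx (N *m x) *m (U *m y)]crossmxC.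
rewrite [crossmx (U *m x) *m (N *m y)]crossmxC mulmxN opprK.
by rewrite ?mulmxDr ?mulmxBr ?mulmxN opprD opprK addrC.
Qed.

Lemma tr_sandwich (X : 'M[R]_(6, 3)) (Y : 'M[R]_(3, 6)) (A : 'M[R]_3) :
  \tr (X *m A *m Y) = \tr (A *m (Y *m X)).
Proof. by rewrite mxtrace_mulC (mulmxA Y) (mxtrace_mulC (Y *m X)). Qed.

Lemma mul_sandwich (X X' : 'M[R]_(6, 3)) (Y Y' : 'M[R]_(3, 6)) (A A' : 'M[R]_3) :
  (X *m A *m Y) *m (X' *m A' *m Y') = X *m (A *m (Y *m X') *m A') *m Y'.
Proof. by rewrite !mulmxA. Qed.

Lemma mxtraceB (A B : 'M[R]_6) : \tr (A - B) = \tr A - \tr B.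
Proof. exact: raddfB. Qed.

(** Left invariant fields on a unimodular group are divergence free; this removes the first of the
    three curvature terms from the Ricci tensor. *)
Lemma tr_connection_r y : \tr (connection_r y) = 0.
Proof.
rewrite /connection_r linearZ linearB mulmxBr linearB /= !mulmxA !tr_sandwich.
by rewrite proj_inj_ctr ctr_form_gen_dual proj_dual_block !mulmx0 linear0 tr_crossmx_sym // !subr0 mulr0.
Qed.

Lemma tr_connectionM x y : \tr (connection x *m connection_r y) =
  4^-1 * \tr (crossmx (N *m x) *m P *m crossmx (N *m y) *m P).
Proof.
rewrite /connection /connection_r.
set a := crossmx (U *m x); set b := crossmx (U *m y).
set na := crossmx (N *m x); set nb := crossmx (N *m y).
rewrite -scalemxAl -scalemxAr !linearZ /= mulrA.
have -> : 2^-1 * 2^-1 = 4^-1 :> R by field.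
congr (_ * _).
(* Transposition exchanges the two mixed terms, which occur with opposite signs; only the term
   quadratic in [P] survives. *)
have PE : \tr (a *m E *m b *m P) = \tr (a *m P *m b *m E).
  rewrite -mxtrace_tr !trmx_mul PT ET /b /a !tr_crossmx.
  rewrite !(mulNmx, mulmxN) opprK.
  by rewrite -!mulmxA mxtrace_mulC -!mulmxA mxtrace_mulC -!mulmxA mxtrace_mulC !mulmxA.
rewrite !(mulmxBr L) !(mulmxA L) !(mulmxBr, mulmxBl) !mxtraceB.
rewrite !mul_sandwich !tr_sandwich.
rewrite !(proj_inj_ctr, ctr_form_gen_dual, proj_dual_block, ctr_form_inj_ctr, mulmx0, mul0mx, linear0, subr0, sub0r, addr0, add0r).
by rewrite PE !opprK addrAC subrr add0r.
Qed.

Lemma tr_connection_bracket x y : \tr (connection_r y *m (W *m crossmx (U *m x) *m U)) =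
  2^-1 * \tr (crossmx (U *m y) *m E *m crossmx (U *m x) *m P).
Proof.
rewrite /connection_r -scalemxAl linearZ /=; congr (_ * _).
rewrite mulmxBr !mulmxBl !(mulmxA L) !mul_sandwich !mxtraceB !tr_sandwich.
by rewrite !(proj_inj_ctr, ctr_form_inj_ctr, proj_dual_block, mulmx0, mul0mx, linear0, subr0).
Qed.

End Connection.

Variable g : 'M[R]_6.
Hypothesis gm : is_metric g.

Let gT : g^T = g := gm.1.
Let gu : g \in unitmx := gm.2.
Let G := invmx g.
Let N := W^T *m g.
Let L := G *m U^T.

Definition dual_block : 'M[R]_3 := ulsubmx (invmx g : 'M_(3 + 3)).
Definition ctr_block : 'M[R]_3 := drsubmx (g : 'M_(3 + 3)).
Local Notation P := dual_block.
Local Notation E := ctr_block.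

Lemma invmx_metric_sym : (invmx g)^T = invmx g.
Proof. by rewrite trmx_inv gT. Qed.

Lemma dual_block_sym : P^T = P.
Proof. by rewrite /dual_block trmx_ulsub invmx_metric_sym. Qed.

Lemma ctr_block_sym : E^T = E.
Proof. by rewrite /ctr_block trmx_drsub gT. Qed.

Lemma proj_dual_block : U *m L = P.
Proof.
rewrite /L /dual_block -/G -{1}(submxK (G : 'M_(3 + 3))).
rewrite (@tr_row_mx _ 3 3 3) trmx1 trmx0 (@mul_block_col _ 3 3 3 3) !mulmx0 !addr0 !mulmx1.
by rewrite (@mul_row_col _ _ 3 3) mul1mx mul0mx addr0.
Qed.

Lemma ctr_form_inj_ctr : N *m W = E.
Proof.
rewrite /N /ctr_block -{1}(submxK (g : 'M_(3 + 3))).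
rewrite (@tr_col_mx _ 3 3 3) trmx1 trmx0 -mulmxA (@mul_block_col _ 3 3 3 3) !mulmx0 !add0r !mulmx1.
by rewrite (@mul_row_col _ _ 3 3) mul1mx mul0mx add0r.
Qed.

Lemma ctr_form_gen_dual : N *m L = 0.
Proof.
by rewrite /N /L /G mulmxA mulmxK // -trmx_mul proj_inj_ctr trmx0.
Qed.

Lemma invmx_ctr_form : G *m N^T = W.
Proof. by rewrite /N trmx_mul trmxK gT mulmxA mulVmx // mul1mx. Qed.

Lemma inner_bracket x y z :
  inner g (bracket x y) z = ((crossmx (U *m x) *m (U *m y))^T *m (N *m z)) 0 0.
Proof. by rewrite /inner bracketE trmx_mul -!mulmxA. Qed.

Lemma koszulE x y z : koszul g x y z =
  (((N^T *m (crossmx (U *m x) *m (U *m y))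
    - U^T *m (crossmx (N *m x) *m (U *m y) - crossmx (U *m x) *m (N *m y))))^T *m z) 0 0.
Proof.
rewrite linearB /= mulmxBl [RHS]mxE [X in _ = _ + X]mxE.
rewrite [(N^T *m _)^T]trmx_mul [(U^T *m _)^T]trmx_mul !trmxK -!mulmxA.
by rewrite /koszul !inner_bracket -addrA triple_product /N -!mulmxA.
Qed.

Local Notation conn := (connection N L).
Local Notation conn_r := (connection_r N L).

Lemma nablaE x y : nabla g x y = conn x *m y.
Proof.
rewrite /nabla -/G /connection.
set V := N^T *m (crossmx (U *m x) *m (U *m y))
    - U^T *m (crossmx (N *m x) *m (U *m y) - crossmx (U *m x) *m (N *m y)).
have -> : \col_k (koszul g x y (delta_mx k 0) / 2) = 2^-1 *: V.
  apply/matrixP => k j; rewrite ord1 2!mxE koszulE -/V mulrC; congr (_ * _).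
  by rewrite -colE !mxE.
rewrite -scalemxAr -scalemxAl; congr (_ *: _).
rewrite /V mulmxBr !(mulmxA G) invmx_ctr_form -/L.
by move: N L => N' L'; rewrite mulmxBl -!mulmxA mulmxBl -!mulmxA.
Qed.

Lemma ricci_tensorE x y : ricci_tensor g x y =
  2^-1 * \tr (crossmx (U *m y) *m E *m crossmx (U *m x) *m P)
  - 4^-1 * \tr (crossmx (N *m x) *m P *m crossmx (N *m y) *m P).
Proof.
(* The matrix of [z |-> R(z,x)y]; the last sign is positive because [- [z,x] = [x,z]]. *)
pose Z := conn_r (conn x *m y) - conn x *m conn_r y
          + conn_r y *m (W *m crossmx (U *m x) *m U).
have -> : ricci_tensor g x y = \tr Z.
  apply: eq_bigr => k _; rewrite /curvature !nablaE.
  have -> (A : 'M[R]_6) : A k k = (A *m (delta_mx k 0 : 'cV_6)) k 0.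
    by rewrite -colE mxE.
  congr (fun_of_matrix _ k 0); rewrite /Z mulmxDl mulmxBl.
  rewrite (connection_rE N L (delta_mx k 0) (_ *m y)) (connection_rE N L (delta_mx k 0) y).
  rewrite (connection_rE N L (bracket _ _) y) -(mulmxA (conn x)); congr (_ + _).
  rewrite -mulmxN -[RHS]mulmxA bracketE -!mulmxA.
  by rewrite [crossmx (U *m delta_mx k 0) *m _]crossmxC !mulmxN opprK.
rewrite /Z linearD linearB /=.
rewrite (tr_connection_r dual_block_sym proj_dual_block ctr_form_gen_dual) sub0r.
rewrite (tr_connectionM dual_block_sym ctr_block_sym proj_dual_block ctr_form_inj_ctr
  ctr_form_gen_dual).
by rewrite (tr_connection_bracket proj_dual_block ctr_form_inj_ctr) addrC.
Qed.

Lemma ricci_operatorE : ricci_operator g =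
  2^-1 *: (W *m cof3 P *m N - L *m polar P E *m U).
Proof.
rewrite /ricci_operator -/G.
have -> : \matrix_(i, j) ricci_tensor g (delta_mx j 0) (delta_mx i 0) =
  2^-1 *: (N^T *m cof3 P *m N - U^T *m polar P E *m U).
  apply/matrixP => i j; rewrite mxE ricci_tensorE.
  rewrite tr_crossmx_polar ?dual_block_sym ?ctr_block_sym //.
  rewrite tr_crossmx_cof ?dual_block_sym //.
  have bE (A : 'M[R]_3) (F : 'M[R]_(3, 6)) :
    ((F *m (delta_mx i 0 : 'cV_6))^T *m (A *m (F *m (delta_mx j 0 : 'cV_6)))) 0 0 =
     (F^T *m A *m F) i j.
    transitivity (((delta_mx i 0 : 'cV_6)^T *m (F^T *m A *m F)
                   *m (delta_mx j 0 : 'cV_6)) 0 0); first by rewrite trmx_mul !mulmxA.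
    by move: (F^T *m A *m F) => B; rewrite trmx_delta -rowE -colE !mxE.
  rewrite !bE.
  rewrite [in RHS]mxE [X in _ = _ * X]mxE [X in _ = _ * (_ + X)]mxE.
  by field.
by rewrite -scalemxAr mulmxBr !(mulmxA G) invmx_ctr_form -/L.
Qed.

End Ricci.

(** * The soliton equation and isometries *)

Section Solitons.
Variable R : realType.
Local Notation U := (proj_gen R).
Local Notation W := (inj_ctr R).

Lemma proj_genK : U *m U^T = 1%:M.
Proof.
by rewrite (@tr_row_mx _ 3 3 3) (@mul_row_col _ _ 3 3) trmx1 trmx0 mulmx1 mulmx0 addr0.
Qed.

Lemma inj_ctrK : W^T *m W = 1%:M.
Proof.
by rewrite (@tr_col_mx _ 3 3 3) (@mul_row_col _ _ 3 3) trmx1 trmx0 mulmx1 mulmx0 add0r.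
Qed.

Lemma gen_ctr_split : U^T *m U + W *m W^T = 1%:M.
Proof.
rewrite (@tr_col_mx _ 3 3 3) (@tr_row_mx _ 3 3 3) trmx1 trmx0.
rewrite !(@mul_col_row _ 3 3 _ 3 3) !(mulmx0, mul0mx, mulmx1) (@add_block_mx _ 3 3 3 3).
by rewrite !(addr0, add0r) -(@scalar_mx_block _ 3 3).
Qed.

Lemma gen_ctr_decl n (A : 'M[R]_(6, n)) : A = U^T *m (U *m A) + W *m (W^T *m A).
Proof. by rewrite !mulmxA -mulmxDl gen_ctr_split mul1mx. Qed.

Lemma gen_ctr_decr n (A : 'M[R]_(n, 6)) : A = (A *m U^T) *m U + (A *m W) *m W^T.
Proof. by rewrite -!mulmxA -mulmxDr gen_ctr_split mulmx1. Qed.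

(** The block from generators to centre stays free: a map into the centre that kills the centre is a
    derivation. *)
Lemma derivationP (D : 'M[R]_6) : derivation D <->
  U *m D *m W = 0 /\
  W^T *m D *m W = (\tr (U *m D *m U^T))%:M - (U *m D *m U^T)^T.
Proof.
split=> [dD|[D0 D1] x y].
  (* Brackets of generators span the centre, so testing on them determines [D] there. *)
  have H (u v : 'cV[R]_3) : D *m W *m (crossmx u *m v) = W *m
     (((\tr (U *m D *m U^T))%:M - (U *m D *m U^T)^T) *m (crossmx u *m v)).
    have := dD (U^T *m u) (U^T *m v); rewrite !bracketE.
    rewrite -mulmxDr !(mulmxA U U^T) proj_genK !mul1mx (mulmxA D) => ->.
    by rewrite -crossmx_deriv !mulmxA.
  split; apply: crossmx_span => u v; rewrite -2!mulmxA (mulmxA D) H.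
    by rewrite mulmxA proj_inj_ctr !mul0mx.
  by rewrite mulmxA inj_ctrK mul1mx.
rewrite !bracketE -mulmxDr.
have UD : U *m D = (U *m D *m U^T) *m U by rewrite {1}[U *m D]gen_ctr_decr D0 mul0mx addr0.
have DW : D *m W = W *m (W^T *m D *m W).
  by rewrite {1}[D *m W]gen_ctr_decl !(mulmxA U) D0 mulmx0 add0r !mulmxA.
rewrite (mulmxA D) DW -mulmxA; congr (_ *m _).
rewrite (mulmxA U D x) (mulmxA U D y) UD -!(mulmxA _ U) crossmx_deriv.
by rewrite D1.
Qed.

Lemma automorphismP (A : 'M[R]_6) : automorphism A <->
  [/\ U *m A *m U^T \in unitmx, U *m A *m W = 0
    & W^T *m A *m W = cof3 (U *m A *m U^T)].
Proof.
split=> [[uA hA]|[uB A0 A1]].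
  have H (u v : 'cV[R]_3) : A *m W *m (crossmx u *m v) =
      W *m (cof3 (U *m A *m U^T) *m (crossmx u *m v)).
    have := hA (U^T *m u) (U^T *m v); rewrite !bracketE.
    rewrite !(mulmxA U U^T) proj_genK !mul1mx (mulmxA A) => ->.
    by rewrite -cof3_crossmx !mulmxA.
  have A0 : U *m A *m W = 0.
    apply: crossmx_span => u v; rewrite -2!mulmxA (mulmxA A) H.
    by rewrite mulmxA proj_inj_ctr !mul0mx.
  split=> //.
    have UA : U *m A = (U *m A *m U^T) *m U by rewrite {1}[U *m A]gen_ctr_decr A0 mul0mx addr0.
    apply: (proj1 (@mulmx1_unit _ _ _ (U *m invmx A *m U^T) _)).
    by rewrite !mulmxA -UA mulmxK // proj_genK.
  apply: crossmx_span => u v; rewrite -2!mulmxA (mulmxA A) H.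
  by rewrite mulmxA inj_ctrK mul1mx.
have UA : U *m A = (U *m A *m U^T) *m U by rewrite {1}[U *m A]gen_ctr_decr A0 mul0mx addr0.
have AW : A *m W = W *m (W^T *m A *m W).
  by rewrite {1}[A *m W]gen_ctr_decl !(mulmxA U) A0 mulmx0 add0r !mulmxA.
split; last first.
  move=> x y; rewrite !bracketE (mulmxA A) AW -mulmxA; congr (_ *m _).
  by rewrite (mulmxA U A x) (mulmxA U A y) UA -!(mulmxA _ U) cof3_crossmx A1.
set B := U *m A *m U^T in uB UA A1.
set K := W^T *m A *m W in A1 AW.
have uK : K \in unitmx by rewrite A1 cof3_unit.
(* The inverse is block lower triangular with diagonal blocks [B^-1], [K^-1]. *)
pose A' := U^T *m invmx B *m U + W *m invmx K *m W^T
           - W *m invmx K *m (W^T *m A *m U^T *m invmx B *m U).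
apply: (proj1 (@mulmx1_unit _ _ _ A' _)).
have AWK (X : 'M[R]_(3, 6)) : A *m (W *m invmx K *m X) = W *m X.
  by rewrite -mulmxA (mulmxA A) AW -mulmxA (mulmxA K) mulmxV // mul1mx.
rewrite /A' mulmxBr mulmxDr !AWK.
have -> : A *m (U^T *m invmx B *m U) =
   U^T *m U + W *m (W^T *m A *m U^T *m invmx B *m U).
  rewrite {1}[A *m _]gen_ctr_decl !mulmxA; congr (_ + _).
  by rewrite -!mulmxA (mulmxA U A) (mulmxA (U *m A)) -/B (mulmxA B) mulmxV // mul1mx.
by rewrite !mulmxA addrAC addrK gen_ctr_split.
Qed.

Lemma dual_blockE (g : 'M[R]_6) : dual_block g = U *m invmx g *m U^T.
Proof. by rewrite -proj_dual_block mulmxA. Qed.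

Lemma ctr_blockE (g : 'M[R]_6) : ctr_block g = W^T *m g *m W.
Proof. by rewrite -ctr_form_inj_ctr. Qed.

Lemma nilsolitonP (g : 'M[R]_6) (gamma : R) : nilsoliton g gamma <->
  is_metric g /\ cof3 (dual_block g) *m ctr_block g = (- (2 * gamma / 5))%:M.
Proof.
have step : is_metric g ->
    (exists2 D : 'M[R]_6, derivation D & ricci_operator g = gamma%:M + D) <->
    cof3 (dual_block g) *m ctr_block g = (- (2 * gamma / 5))%:M; last first.
  by split=> [[gm /(step gm) ?]|[gm /(step gm) ?]]; split.
move=> gm; set P := dual_block g; set E := ctr_block g.
have PT : P^T = P := dual_block_sym gm.
have ET : E^T = E := ctr_block_sym gm.
set Ric := ricci_operator g.
have URW : U *m Ric *m W = 0.
  rewrite /Ric ricci_operatorE // -scalemxAr -scalemxAl mulmxBr mulmxBl.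
  by rewrite -!mulmxA proj_inj_ctr !mulmx0 !mulmxA proj_inj_ctr !mul0mx subr0 scaler0.
have URU : U *m Ric *m U^T = - (2^-1 *: (P *m polar P E)).
  rewrite /Ric ricci_operatorE // -scalemxAr -scalemxAl mulmxBr mulmxBl.
  rewrite !mulmxA proj_inj_ctr !mul0mx sub0r -dual_blockE -/P -/E.
  by rewrite -(mulmxA _ U) proj_genK mulmx1 scalerN.
have WRW : W^T *m Ric *m W = 2^-1 *: (cof3 P *m E).
  rewrite /Ric ricci_operatorE // -scalemxAr -scalemxAl mulmxBr mulmxBl.
  rewrite -!mulmxA proj_inj_ctr !mulmx0 subr0 (mulmxA W^T W) inj_ctrK mul1mx.
  by rewrite (mulmxA W^T) -ctr_blockE.
have polE := polar_mul PT ET.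
have trP : (polar P E)^T = polar P E.
  by rewrite /polar !linearB /= -!cof3_tr linearD /= PT ET.
have trE : \tr (polar P E *m P) = 2 * \tr (cof3 P *m E).
  have := congr1 (@mxtrace R 3) polE; rewrite mxtraceD mxtrace_scalar => H.
  by apply: (addIr (\tr (cof3 P *m E))); rewrite H -[_ *+ 3]mulr_natr; ring.
set Y := cof3 P *m E in WRW polE trE *.
have polY : polar P E *m P = (\tr Y)%:M - Y by rewrite -polE addrK.
(* The generator block [X] of [Ric - gamma] has [X^T = (Y - \tr Y) / 2 - gamma] and trace
   [- \tr Y - 3 gamma]. Equating the centre block [Y / 2 - gamma] with [\tr X - X^T] gives
   [Y = - \tr Y / 2 - gamma]. So [Y] is a scalar [c], and [\tr Y = 3 c] yields the factor 5/2. *)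
have condE : derivation (Ric - gamma%:M) <-> Y = (- (\tr Y / 2 + gamma))%:M.
  rewrite derivationP mulmxBr mulmxBl URW mul_mx_scalar -scalemxAl proj_inj_ctr scaler0 subr0.
  rewrite !mulmxBr !mulmxBl WRW URU !mul_mx_scalar -!scalemxAl inj_ctrK proj_genK.
  rewrite linearB /= mxtraceZ mxtrace1 linearN /= mxtraceZ mxtrace_mulC trE.
  have -> (A : 'M[R]_3) : (- (2^-1 *: A) - gamma *: 1%:M)^T = - (2^-1 *: A^T) - gamma%:M.
    by apply/matrixP => i j; rewrite !mxE eq_sym mulr_natr.
  rewrite trmx_mul trP PT polY.
  rewrite !scalemx1.
  clear -Y.
  have [a [b [c [d [e [f [h [i [j ->]]]]]]]]] := mx3P Y.
  rewrite /diag3 ?(cof3E, mx3_simpl).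
  split=> [[_ /mx3_inj[[? ? ?] [? ? ?] [? ? ?]]]|/mx3_inj[[? ? ?] [? ? ?] [? ? ?]]].
    by apply: mx3_eq; lra.
  by split=> //; apply: mx3_eq; lra.
split=> [[D dD RE]|H].
  have {}RE : D = Ric - gamma%:M by rewrite RE addrC addKr.
  move: dD; rewrite RE => /condE YE.
  have := congr1 (@mxtrace R 3) YE; rewrite mxtrace_scalar -[_ *+ 3]mulr_natr => tY.
  by rewrite YE; congr (_%:M); lra.
exists (Ric - gamma%:M); last by rewrite addrC subrK.
apply/condE; rewrite H mxtrace_scalar; congr (_%:M).
rewrite -[_ *+ 3]mulr_natr; by field.
Qed.

Lemma isometric_refl (g : 'M[R]_6) : isometric g g.
Proof.
exists 1%:M; last by rewrite trmx1 mul1mx mulmx1.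
by split=> [|x y]; rewrite ?unitmx1 ?mul1mx.
Qed.

Lemma isometric_sym (g h : 'M[R]_6) : isometric g h -> isometric h g.
Proof.
move=> [A [uA hA] ->]; exists (invmx A).
  split=> [|x y]; first by rewrite unitmx_inv.
  by rewrite -[RHS](mulKmx uA) hA !mulKVmx.
by rewrite trmx_inv !mulmxA mulVmx ?unitmx_tr // mul1mx mulmxK.
Qed.

Lemma isometric_trans (g h k : 'M[R]_6) :
  isometric g h -> isometric h k -> isometric g k.
Proof.
move=> [A [uA hA] ->] [B [uB hB] ->]; exists (B *m A).
  by split=> [|x y]; rewrite ?unitmx_mul ?uA ?uB // -!mulmxA hA hB.
by rewrite trmx_mul !mulmxA.
Qed.

Lemma isometric_is_metric (g h : 'M[R]_6) :
  isometric g h -> is_metric h -> is_metric g.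
Proof.
move=> [A [uA _] ->] [hT uh]; split; first by rewrite !trmx_mul trmxK hT mulmxA.
by rewrite !unitmx_mul unitmx_tr uA uh.
Qed.

(** No equivariance of the Ricci operator is needed: [P] of [h] is [B P B^T] for [P] of [g], while
    [E] changes by congruence with [cof3 B]. Hence [cof3 P *m E] is conjugated by [cof3 B], which
    fixes scalar matrices. *)
Lemma isometric_nilsoliton (g h : 'M[R]_6) gamma :
  isometric g h -> nilsoliton h gamma -> nilsoliton g gamma.
Proof.
move=> gh /nilsolitonP[mh hE]; apply/nilsolitonP.
split; first exact: isometric_is_metric gh mh.
case: gh => A aA ->; have [uA _] := aA.
have [uB A0 A1] := (automorphismP A).1 aA.
set B := U *m A *m U^T in uB A1.
have UA : U *m A = B *m U by rewrite {1}[U *m A]gen_ctr_decr A0 mul0mx addr0.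
have AW : A *m W = W *m cof3 B.
  by rewrite {1}[A *m W]gen_ctr_decl !(mulmxA U) A0 mulmx0 add0r -A1 !mulmxA.
have uK : cof3 B \in unitmx by rewrite cof3_unit.
have gu := mh.2.
have PE : dual_block h = B *m dual_block (A^T *m h *m A) *m B^T.
  rewrite !dual_blockE !mulmxA -UA -!mulmxA -trmx_mul -UA trmx_mul.
  congr (_ *m _); rewrite !mulmxA; congr (_ *m _).
  have uT : A^T \in unitmx by rewrite unitmx_tr.
  apply: (can_inj (mulKmx gu)); apply: (can_inj (mulKmx uT)).
  by rewrite mulmxV // mulmx1 !mulmxA mulmxV ?mul1mx // !unitmx_mul uT gu.
have EE : ctr_block (A^T *m h *m A) = (cof3 B)^T *m ctr_block h *m cof3 B.
  rewrite !ctr_blockE -!mulmxA AW !mulmxA -trmx_mul AW trmx_mul.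
  by rewrite -!mulmxA.
rewrite EE; move: hE; rewrite PE !cof3M cof3_tr.
set P := cof3 (dual_block _) => hE.
have -> : P *m ((cof3 B)^T *m ctr_block h *m cof3 B) =
  invmx (cof3 B) *m (cof3 B *m P *m (cof3 B)^T *m ctr_block h) *m cof3 B.
  by rewrite !mulmxA mulVmx // mul1mx.
by rewrite hE mul_mx_scalar -scalemxAl mulVmx // scalemx1.
Qed.

(** [B] acts on generators and [C] is the free block into the centre. The new blocks enter through
    equations, so that a caller can prescribe them or leave them to unification. *)
Lemma isometric_transform (B C S M E S' M' E' : 'M[R]_3) : B \in unitmx ->
  S' = B^T *m S *m B + B^T *m M *m C + C^T *m M^T *m B + C^T *m E *m C ->
  M' = (B^T *m M + C^T *m E) *m cof3 B ->
  E' = (cof3 B)^T *m E *m cof3 B -> E^T = E ->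
  isometric (metric S M E) (metric S' M' E').
Proof.
move=> uB -> -> -> ET; apply: isometric_sym; exists (block_mx B 0 C (cof3 B)).
  apply/automorphismP.
  have -> : U *m block_mx B 0 C (cof3 B) = row_mx B 0.
    by rewrite (@mul_row_block _ _ 3 3 3 3) !mul1mx !mul0mx !addr0.
  have -> : W^T *m block_mx B 0 C (cof3 B) = row_mx C (cof3 B).
    rewrite (@tr_col_mx _ 3 3 3) trmx1 trmx0.
    by rewrite (@mul_row_block _ _ 3 3 3 3) !mul1mx !mul0mx !add0r.
  rewrite (@tr_row_mx _ 3 3 3) trmx1 trmx0 !(@mul_row_col _ _ 3 3).
  by rewrite !mulmx0 !mulmx1 !addr0 add0r.
rewrite /metric (@tr_block_mx _ 3 3 3 3) trmx0 !(@mulmx_block _ 3 3 3 3 3 3).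
rewrite !(mul0mx, mulmx0, add0r, addr0); congr (@block_mx _ 3 3 3 3 _ _ _ _).
- by rewrite !mulmxDl !addrA [X in _ = X + _]addrAC.
- rewrite trmx_mul (linearD (@trmx _ _ _)) /= !trmx_mul !trmxK ET mulmxDr.
  by rewrite !mulmxA.
Qed.

End Solitons.

(** * Nilsolitons in block form, with explicit inverses *)

Section NormalForms.
Variable R : realType.
Implicit Types S M E P Q T : 'M[R]_3.

(** Replaces [invmx] by inverse blocks given as witnesses, so that a normal form is checked by 3x3
    arithmetic. *)
Lemma nilsoliton_metricP S M E gamma : nilsoliton (metric S M E) gamma <->
  [/\ S^T = S, E^T = E & exists P Q T,
    [/\ P^T = P, T^T = T,
        [/\ S *m P + M *m Q^T = 1%:M, S *m Q + M *m T = 0,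
            M^T *m P + E *m Q^T = 0 & M^T *m Q + E *m T = 1%:M]
      & cof3 P *m E = (- (2 * gamma / 5))%:M]].
Proof.
have one6 : (1%:M : 'M[R]_6) = block_mx (1%:M : 'M_3) (0 : 'M_3) (0 : 'M_3) 1%:M.
  by rewrite -(@scalar_mx_block _ 3 3).
rewrite nilsolitonP /ctr_block /metric (@block_mxKdr _ 3 3 3 3).
split=> [[gm cE]|[ST ET [P [Q [T [PT TT [e1 e2 e3 e4] cE]]]]]].
  have [gT gu] := gm.
  have [ST _ _ ET] : [/\ S^T = S, M^T^T = M, M^T = M^T & E^T = E].
    by move: gT; rewrite (@tr_block_mx _ 3 3 3 3) => /(@eq_block_mx _ 3 3 3 3).
  split=> //; set G := invmx (block_mx S M M^T E) : 'M_(3 + 3).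
  have GT : G^T = G by exact: invmx_metric_sym gm.
  have GE : G = block_mx (ulsubmx G) (ursubmx G) (ursubmx G)^T (drsubmx G).
    by rewrite trmx_ursub GT submxK.
  exists (ulsubmx G), (ursubmx G), (drsubmx G).
  split=> //; rewrite ?trmx_ulsub ?trmx_drsub ?GT //.
  apply: (@eq_block_mx _ 3 3 3 3).
  by rewrite -(@mulmx_block _ 3 3 3 3 3 3) -GE -one6; exact: mulmxV gu.
have inv : (block_mx S M M^T E : 'M[R]_6) *m block_mx P Q Q^T T = 1%:M.
  by rewrite (@mulmx_block _ 3 3 3 3 3 3) e1 e2 e3 e4 one6.
have gu := (mulmx1_unit inv).1.
split; first by split=> //; rewrite (@tr_block_mx _ 3 3 3 3) trmxK ST ET.
have -> : dual_block (block_mx S M M^T E) = P; last by [].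
rewrite /dual_block.
have -> : invmx (block_mx S M M^T E : 'M[R]_6) = block_mx P Q Q^T T.
  by rewrite -[LHS]mulmx1 -inv mulKmx.
by rewrite (@block_mxKul _ 3 3 3 3).
Qed.

Lemma metric_unitP S M E gamma (u v : 'cV[R]_3) :
  nilsoliton (metric S M E) gamma -> S *m u + M *m v = 0 -> M^T *m u + E *m v = 0 ->
  u = 0 /\ v = 0.
Proof.
move=> [[_ gu] _] h1 h2.
have : metric S M E *m (col_mx u v : 'cV[R]_6) = 0.
  by rewrite (@mul_block_col _ 3 3 3 3) h1 h2 col_mx0.
move=> /(congr1 (mulmx (invmx (metric S M E)))); rewrite mulKmx // mulmx0.
by rewrite -[0](@col_mx0 _ 3 3 1) => /(@eq_col_mx _ 3 3).
Qed.

(** The two signs cover [E30], [E21] and their opposites together; here [P] is the inverse of [S]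
    and [cof3 P *m E] is the scalar [a c / l^2]. *)
Lemma nilsoliton_scaled (l a c : R) : l != 0 -> a ^+ 2 = 1 -> c ^+ 2 = 1 ->
  nilsoliton (metric (diag3 l l (l * a)) 0 (diag3 c c (c * a)))
    (- (5 * (a * c) / (2 * l ^+ 2))).
Proof.
move=> l0 a1 c1; apply/nilsoliton_metricP; split; [by mx3_ring|by mx3_ring|].
exists (diag3 l^-1 l^-1 (l^-1 * a)), 0, (diag3 c c (c * a)).
split; [by mx3_ring|by mx3_ring| |].
  split; rewrite /diag3 ?(cof3E, mx3_simpl); apply: mx3_eq; try by field.
  all: try by rewrite -[RHS]c1; field.
    by rewrite -[RHS]a1; field.
  by transitivity (c ^+ 2 * a ^+ 2); [ring|rewrite c1 a1 mulr1].
rewrite /diag3 ?(cof3E, mx3_simpl); apply: mx3_eq; try by field.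
Qed.

(** [P] lives on the last two axes, so [cof3 P] has only its first diagonal entry, and [E]
    annihilates that axis. *)
Lemma nilsoliton_rank2 (x y z a b : R) : x * z - y ^+ 2 != 0 -> a != 0 -> b != 0 ->
  nilsoliton (metric (mx3 [:: [:: 0; 0; 0]; [:: 0; x; y]; [:: 0; y; z]])
    (M2 R) (diag3 0 a b)) 0.
Proof.
move=> d0 a0 b0; apply/nilsoliton_metricP; split; [by mx3_ring|by mx3_ring|].
exists (mx3 [:: [:: 0; 0; 0]; [:: 0; z / (x * z - y ^+ 2); - y / (x * z - y ^+ 2)];
    [:: 0; - y / (x * z - y ^+ 2); x / (x * z - y ^+ 2)]]),
  (M2 R), (diag3 0 a^-1 b^-1).
rewrite /M2; split; [by mx3_ring|by mx3_ring| |].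
  by split; mx3_field; rewrite ?d0 ?a0 ?b0.
by mx3_field.
Qed.

(** [P] has rank one, hence [cof3 P = 0]. As [P] and [E] sit on different axes, [polar P E] is not
    zero and the Ricci operator is a nonzero derivation. *)
Lemma nilsoliton_rank1 (p q r s t h : R) : p * s - q * r != 0 -> t != 0 -> h != 0 ->
  nilsoliton (metric (diag3 0 t 0)
   (mx3 [:: [:: p; q; 0]; [:: 0; 0; 0]; [:: r; s; 0]]) (diag3 0 0 h)) 0.
Proof.
move=> d0 t0 h0; apply/nilsoliton_metricP; split; [by mx3_ring|by mx3_ring|].
exists (diag3 0 t^-1 0),
  (mx3 [:: [:: s / (p * s - q * r); - r / (p * s - q * r); 0]; [:: 0; 0; 0];
           [:: - q / (p * s - q * r); p / (p * s - q * r); 0]]),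
  (diag3 0 0 h^-1).
split; [by mx3_ring|by mx3_ring| |].
  by split; mx3_field; rewrite ?d0 ?t0 ?h0.
by mx3_field.
Qed.

(** Now [P] and [E] are multiples of one rank-one matrix, so [polar P E] vanishes along with
    [cof3 P] and the metric is Ricci-flat. *)
Lemma nilsoliton_rank1_flat (p q r s t h : R) : p * s - q * r != 0 -> t != 0 -> h != 0 ->
  nilsoliton (metric (diag3 0 0 t)
   (mx3 [:: [:: p; q; 0]; [:: r; s; 0]; [:: 0; 0; 0]]) (diag3 0 0 h)) 0.
Proof.
move=> d0 t0 h0; apply/nilsoliton_metricP; split; [by mx3_ring|by mx3_ring|].
exists (diag3 0 0 t^-1),
  (mx3 [:: [:: s / (p * s - q * r); - r / (p * s - q * r); 0];
           [:: - q / (p * s - q * r); p / (p * s - q * r); 0]; [:: 0; 0; 0]]),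
  (diag3 0 0 h^-1).
split; [by mx3_ring|by mx3_ring| |].
  by split; mx3_field; rewrite ?d0 ?t0 ?h0.
by mx3_field.
Qed.

Lemma nilsoliton_rank0 M : M \in unitmx -> nilsoliton (metric 0 M 0) 0.
Proof.
move=> uM; apply/nilsoliton_metricP; rewrite trmx0; split=> //.
exists 0, (invmx M)^T, 0; rewrite trmx0 trmxK !mulmx0 !mul0mx !addr0 !add0r.
split=> //; last by rewrite mulr0 mul0r oppr0 scalar_mx3 const_mx3.
by rewrite mulmxV // -trmx_mul mulVmx // trmx1.
Qed.

End NormalForms.

(** * The metric on the centre *)

Ltac det_simp :=
  rewrite ?(mulr0, mul0r, mulr1, mul1r, subr0, sub0r, addr0, add0r, oppr0, mulrN, mulNr, opprK);
  rewrite ?oppr_eq0 ?oner_eq0.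

Section Center.
Variable R : realType.
Implicit Types S M E B C K : 'M[R]_3.

Definition classified (g : 'M[R]_6) (gamma : R) : Prop :=
  exists2 h : 'M[R]_6,
    [\/ family_i h gamma, family_ii h gamma, family_iii h gamma
      | omitted_family h gamma] & isometric g h.

Lemma isometric_classified (g h : 'M[R]_6) gamma :
  isometric g h -> classified h gamma -> classified g gamma.
Proof. by move=> gh [k kf hk]; exists k => //; exact: isometric_trans gh hk. Qed.

Lemma nilsoliton_uniq (g : 'M[R]_6) gamma gamma' :
  nilsoliton g gamma -> nilsoliton g gamma' -> gamma = gamma'.
Proof.
move=> /nilsolitonP[_ gE] /nilsolitonP[_]; rewrite gE => /matrixP/(_ 0 0).
by rewrite !mxE /=; lra.
Qed.

Lemma unitmx3 (a b c d e f g h i : R) :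
  a * (e * i - f * h) + b * (f * g - d * i) + c * (d * h - e * g) != 0 ->
  mx3 [:: [:: a; b; c]; [:: d; e; f]; [:: g; h; i]] \in unitmx.
Proof. by rewrite unitmxE det_mx3 unitfE. Qed.

Definition congruent E E' := exists2 K, K \in unitmx & E = K^T *m E' *m K.

Lemma congruent_trans E E' E'' :
  congruent E E' -> congruent E' E'' -> congruent E E''.
Proof.
move=> [K uK ->] [L uL ->]; exists (L *m K); first by rewrite unitmx_mul uK uL.
by rewrite trmx_mul !mulmxA.
Qed.

(* Automorphisms act on the centre by [cof3 B], which is [+-L] for a suitable multiple
   [B] of [cof3 L], because [cof3 (cof3 L) = \det L *: L]. *)
Lemma congruent_isometric S M E E' : congruent E E' -> E'^T = E' ->
  exists S' M', isometric (metric S M E) (metric S' M' E').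
Proof.
move=> [K uK ->] ET.
have uK' : invmx K \in unitmx by rewrite unitmx_inv.
set L := invmx K in uK'.
have dL : \det L != 0 by rewrite -unitfE -unitmxE.
(* [t ^+ 2] cancels the absolute value of the determinant in [cof3 (cof3 L)]; the sign left over
   drops out of a congruence. *)
pose t := Num.sqrt `|\det L|^-1.
have t2 : t ^+ 2 = `|\det L|^-1 by rewrite sqr_sqrtr // invr_ge0 normr_ge0.
have t0 : t != 0 by rewrite -sqrf_eq0 t2 invr_eq0 normr_eq0.
pose B := t *: cof3 L.
have BE : cof3 B = Num.sg (\det L) *: L.
  rewrite /B cof3Z cof3_cof3 scalerA t2; congr (_ *: _).
  by rewrite [X in _ * X]numEsg mulrC mulfK ?normr_eq0.
have uB : B \in unitmx by rewrite unitmxZ ?unitfE // cof3_unit.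
exists (B^T *m S *m B + B^T *m M *m 0 + 0^T *m M^T *m B + 0^T *m (K^T *m E' *m K) *m 0).
exists ((B^T *m M + 0^T *m (K^T *m E' *m K)) *m cof3 B).
apply: (isometric_transform uB erefl erefl); last first.
  by rewrite !trmx_mul trmxK ET mulmxA.
have -> : (cof3 B)^T = Num.sg (\det L) *: L^T by rewrite BE linearZ.
rewrite BE -!scalemxAl -!scalemxAr scalerA -expr2 sqr_sg dL scale1r.
by rewrite !mulmxA -trmx_mul mulmxV // trmx1 mul1mx -mulmxA mulmxV // mulmx1.
Qed.

Lemma congruent3 a b c d e f a' b' c' d' e' f' k1 k2 k3 k4 k5 k6 k7 k8 k9 :
  k1 * (k5 * k9 - k6 * k8) + k2 * (k6 * k7 - k4 * k9) + k3 * (k4 * k8 - k5 * k7) != 0 ->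
  let E' := mx3 [:: [:: a'; b'; c']; [:: b'; d'; e']; [:: c'; e'; f']] in
  let K := mx3 [:: [:: k1; k2; k3]; [:: k4; k5; k6]; [:: k7; k8; k9]] in
  mx3 [:: [:: a; b; c]; [:: b; d; e]; [:: c; e; f]] = K^T *m E' *m K ->
  congruent (mx3 [:: [:: a; b; c]; [:: b; d; e]; [:: c; e; f]]) E'.
Proof. by move=> d0 E' K EE; exists K => //; exact: unitmx3. Qed.

Lemma congruent_swap12 a b c d e f :
  congruent (mx3 [:: [:: a; b; c]; [:: b; d; e]; [:: c; e; f]])
            (mx3 [:: [:: d; b; e]; [:: b; a; c]; [:: e; c; f]]).
Proof.
apply: (congruent3 (k1 := 0) (k2 := 1) (k3 := 0) (k4 := 1) (k5 := 0) (k6 := 0)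
  (k7 := 0) (k8 := 0) (k9 := 1)); last by mx3_ring.
by det_simp.
Qed.

Lemma congruent_swap23 a b c d e f :
  congruent (mx3 [:: [:: a; b; c]; [:: b; d; e]; [:: c; e; f]])
            (mx3 [:: [:: a; c; b]; [:: c; f; e]; [:: b; e; d]]).
Proof.
apply: (congruent3 (k1 := 1) (k2 := 0) (k3 := 0) (k4 := 0) (k5 := 0) (k6 := 1)
  (k7 := 0) (k8 := 1) (k9 := 0)); last by mx3_ring.
by det_simp.
Qed.

Definition diagonalizable E := exists a b c, congruent E (diag3 a b c).

Lemma congruent_diagonalizable E E' :
  congruent E E' -> diagonalizable E' -> diagonalizable E.
Proof.
by move=> EE [a [b [c H]]]; exists a, b, c; exact: congruent_trans EE H.
Qed.

Lemma diagonalizable2 a d e f :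
  diagonalizable (mx3 [:: [:: a; 0; 0]; [:: 0; d; e]; [:: 0; e; f]]).
Proof.
have diagd d' e' f' : d' != 0 ->
    diagonalizable (mx3 [:: [:: a; 0; 0]; [:: 0; d'; e']; [:: 0; e'; f']]).
  move=> d0; exists a, d', (f' - e' ^+ 2 / d').
  apply: (congruent3 (k1 := 1) (k2 := 0) (k3 := 0) (k4 := 0) (k5 := 1) (k6 := e' / d')
    (k7 := 0) (k8 := 0) (k9 := 1)); first by det_simp.
  by rewrite !mx3_simpl; apply: mx3_eq; field.
have [d0|/diagd//] := eqVneq d 0.
have [f0|/diagd H] := eqVneq f 0; last first.
  exact: congruent_diagonalizable (congruent_swap23 _ _ _ _ _ _) (H _ _).
have [e0|e0] := eqVneq e 0.
  exists a, 0, 0; exists 1%:M; first exact: unitmx1.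
  by rewrite trmx1 mulmx1 mul1mx d0 e0 f0.
(* On a hyperbolic plane the sum of the two isotropic basis vectors has square [2 e], which serves
   as pivot. *)
apply: (congruent_diagonalizable _ (diagd (2 * e) e 0 _)); last by rewrite mulf_neq0 // pnatr_eq0.
apply: (congruent3 (k1 := 1) (k2 := 0) (k3 := 0) (k4 := 0) (k5 := 1) (k6 := 0)
    (k7 := 0) (k8 := -1) (k9 := 1)); first by det_simp.
by rewrite d0 f0 !mx3_simpl; apply: mx3_eq; ring.
Qed.

Lemma sym_diagonalizable E : E^T = E -> diagonalizable E.
Proof.
have diaga a b c d e f : a != 0 ->
    diagonalizable (mx3 [:: [:: a; b; c]; [:: b; d; e]; [:: c; e; f]]).
  move=> a0; apply: congruent_diagonalizable
    (diagonalizable2 a (d - b ^+ 2 / a) (e - b * c / a) (f - c ^+ 2 / a)).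
  apply: (congruent3 (k1 := 1) (k2 := b / a) (k3 := c / a) (k4 := 0) (k5 := 1) (k6 := 0)
    (k7 := 0) (k8 := 0) (k9 := 1)); first by det_simp.
  by rewrite !mx3_simpl; apply: mx3_eq; field.
have diagd a b c d e f : d != 0 ->
    diagonalizable (mx3 [:: [:: a; b; c]; [:: b; d; e]; [:: c; e; f]]).
  move=> d0.
  exact: congruent_diagonalizable (congruent_swap12 _ _ _ _ _ _) (diaga _ _ _ _ _ _ d0).
have diagb b c d e f : b != 0 ->
    diagonalizable (mx3 [:: [:: 0; b; c]; [:: b; d; e]; [:: c; e; f]]).
  move=> b0; have [d0|] := eqVneq d 0; last exact: diagd.
  apply: (congruent_diagonalizable _ (diaga (2 * b) b (c + e) 0 e f _)); last first.
    by rewrite mulf_neq0 // pnatr_eq0.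
  apply: (congruent3 (k1 := 1) (k2 := 0) (k3 := 0) (k4 := -1) (k5 := 1) (k6 := 0)
    (k7 := 0) (k8 := 0) (k9 := 1)); first by det_simp.
  by rewrite d0 !mx3_simpl; apply: mx3_eq; ring.
move=> /sym3P[a [b [c [d [e [f ->]]]]]].
have [a0|] := eqVneq a 0; last exact: diaga.
have [b0|] := eqVneq b 0; last by rewrite a0; exact: diagb.
have [c0|] := eqVneq c 0; last first.
  move=> c0; rewrite a0.
  exact: congruent_diagonalizable (congruent_swap23 _ _ _ _ _ _) (diagb _ _ _ _ _ c0).
rewrite b0 c0; exact: diagonalizable2.
Qed.

Definition signs (a : R) : Prop := [\/ a = 0, a = 1 | a = -1].

Lemma sqrt_sign (a : R) : exists k s, [/\ k != 0, signs s & a = k ^+ 2 * s].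
Proof.
have [a0|a0|->] := ltgtP a 0.
- exists (Num.sqrt (- a)), (-1).
  rewrite sqrtr_eq0 -ltNge oppr_gt0 sqr_sqrtr ?oppr_ge0 ?ltW // mulrN1 opprK.
  by split=> //; constructor 3.
- exists (Num.sqrt a), 1.
  by rewrite sqrtr_eq0 -ltNge sqr_sqrtr ?ltW // mulr1; split=> //; constructor 2.
- by exists 1, 0; rewrite mulr0 oner_eq0; split=> //; constructor 1.
Qed.

Lemma congruent_rot a b c : congruent (diag3 a b c) (diag3 c a b).
Proof.
apply: congruent_trans (congruent_swap23 _ _ _ _ _ _) (congruent_swap12 _ _ _ _ _ _).
Qed.

(** The nondegenerate forms are encoded by two signs to treat them uniformly. [- E11] is absent
    because exchanging the last two axes turns it into [E11]. *)
Definition canonical_ctr E : Prop :=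
  [\/ exists a c, [/\ a ^+ 2 = 1, c ^+ 2 = 1 & E = diag3 c c (c * a)],
      exists2 a, a = 1 \/ a = -1 & E = diag3 0 a a,
      E = diag3 0 1 (-1) \/ exists2 a, a = 1 \/ a = -1 & E = diag3 0 0 a
    | E = 0].

Definition has_canonical_ctr E := exists2 E', congruent E E' & canonical_ctr E'.

Lemma congruent_has_canonical E E' :
  congruent E E' -> has_canonical_ctr E' -> has_canonical_ctr E.
Proof. by move=> H [E0 H1 H2]; exists E0 => //; exact: congruent_trans H H1. Qed.

Lemma has_canonical_rot a b c :
  has_canonical_ctr (diag3 c a b) -> has_canonical_ctr (diag3 a b c).
Proof. exact: congruent_has_canonical (congruent_rot a b c). Qed.

Lemma has_canonical_swap a b c :
  has_canonical_ctr (diag3 b a c) -> has_canonical_ctr (diag3 a b c).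
Proof. exact: congruent_has_canonical (congruent_swap12 _ _ _ _ _ _). Qed.

(** These sign triples are canonical as they stand; every other triple reaches one of them by
    permuting the axes. *)
Lemma has_canonical_base a b c :
  [\/ a = 0 /\ b = 0, a = 0 /\ b = 1, [/\ a = 0, b = -1 & c = -1] | a = b /\ b <> 0] ->
  signs a -> signs b -> (b <> 0 -> c <> 0) -> signs c -> has_canonical_ctr (diag3 a b c).
Proof.
move=> H sa sb nc sc; exists (diag3 a b c).
  by exists 1%:M; rewrite ?unitmx1 // trmx1 mulmx1 mul1mx.
case: H => [[-> ->]|[-> b1]|[-> -> ->]|[-> b0]].
- case: sc => ->; first by constructor 4; rewrite const_mx3.
    by constructor 3; right; exists 1 => //; left.
  by constructor 3; right; exists (-1) => //; right.
- rewrite b1 in nc *; case: sc => cE.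
  + by have := nc (elimN eqP (oner_neq0 _)).
  + by rewrite cE; constructor 2; exists 1 => //; left.
  + by rewrite cE; constructor 3; left.
- by constructor 2; exists (-1) => //; right.
- have {}nc := nc b0; constructor 1; exists (b * c), b.
  have b2 : b ^+ 2 = 1 by case: sb => // ->; rewrite ?sqrrN expr1n.
  have c2 : c ^+ 2 = 1 by case: sc => // ->; rewrite ?sqrrN expr1n.
  by rewrite exprMn b2 c2 mulr1; split=> //; rewrite mulrA -expr2 b2 mul1r.
Qed.

End Center.

Ltac canonical_base := solve [apply: has_canonical_base => //;
  first [by constructor 1|by constructor 2|by constructor 3|by constructor 4]].

Section SymCanonical.
Variable R : realType.

Lemma sym_canonical_ctr (E : 'M[R]_3) : E^T = E -> has_canonical_ctr E.
Proof.
move=> /sym_diagonalizable[x [y [z EE]]].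
have [k1 [a [k10 sa xE]]] := sqrt_sign x.
have [k2 [b [k20 sb yE]]] := sqrt_sign y.
have [k3 [c [k30 sc zE]]] := sqrt_sign z.
apply: (@congruent_has_canonical R _ (diag3 a b c)).
  apply: congruent_trans EE _.
  apply: (congruent3 (k1 := k1) (k2 := 0) (k3 := 0) (k4 := 0) (k5 := k2) (k6 := 0)
    (k7 := 0) (k8 := 0) (k9 := k3)).
    by rewrite !mulr0 !mul0r !subr0 !addr0 !mulf_neq0.
  by rewrite xE yE zE !mx3_simpl; apply: mx3_eq; ring.
have n1 : (1 : R) <> 0 by apply/eqP; exact: oner_neq0.
have nm : (-1 : R) <> 0 by apply/eqP; rewrite oppr_eq0 oner_neq0.
have s0 : signs (0 : R) by constructor 1.
have s1 : signs (1 : R) by constructor 2.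
have sm : signs (-1 : R) by constructor 3.
clear EE xE yE zE.
(* All 27 sign triples; the six alternatives run through the permutations of the axes. *)
case: sa => ->; case: sb => ->; case: sc => ->;
  first [ canonical_base
        | apply: has_canonical_rot; canonical_base
        | apply: has_canonical_rot; apply: has_canonical_rot; canonical_base
        | apply: has_canonical_swap; canonical_base
        | apply: has_canonical_swap; apply: has_canonical_rot; canonical_base
        | apply: has_canonical_swap; apply: has_canonical_rot;
          apply: has_canonical_rot; canonical_base ].
Qed.

End SymCanonical.

(** * Classification by the rank of the metric on the centre *)

Section RankThree.
Variable R : realType.
Implicit Types S M E B C K : 'M[R]_3.

Lemma isometric_shear C S M E M' : E^T = E -> M' = M + C^T *m E ->
  exists S', isometric (metric S M E) (metric S' M' E).
Proof.
move=> ET ->; eexists.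
apply: (@isometric_transform R 1%:M C _ _ _ _ _ _ (unitmx1 _ _) erefl) => //.
  by rewrite cof3_1 trmx1 mul1mx mulmx1.
by rewrite cof3_1 trmx1 mul1mx mulmx1.
Qed.

Lemma nilsoliton_transport (g h : 'M[R]_6) gamma :
  isometric g h -> nilsoliton g gamma -> nilsoliton h gamma.
Proof. by move=> /isometric_sym; exact: isometric_nilsoliton. Qed.

Lemma classify_scaled S M (a c gamma : R) : a ^+ 2 = 1 -> c ^+ 2 = 1 ->
  nilsoliton (metric S M (diag3 c c (c * a))) gamma ->
  classified (metric S M (diag3 c c (c * a))) gamma.
Proof.
move=> a1 c1; set E := diag3 c c (c * a) => nil.
have ET : E^T = E by rewrite /E; mx3_ring.
have E2 : E *m E = 1%:M.
  rewrite /E /diag3 !mx3_simpl; apply: mx3_eq; try ring.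
  - by rewrite -c1; ring.
  - by rewrite -c1; ring.
  - by transitivity (c ^+ 2 * a ^+ 2); [ring|rewrite c1 a1 mulr1].
have [S' iso] : exists S', isometric (metric S M E) (metric S' 0 E).
  apply: (@isometric_shear (- (E *m M^T))) => //.
  by rewrite linearN /= trmx_mul trmxK ET mulNmx -mulmxA E2 mulmx1 subrr.
apply: (isometric_classified iso).
have {}nil := nilsoliton_transport iso nil.
have [ST _ [P [Q [T [PT TT [SP _ _ _] cE]]]]] := (nilsoliton_metricP _ _ _ _).1 nil.
rewrite mul0mx addr0 in SP.
have uS := (mulmx1_unit SP).1.
set k := - _ in cE.
(* With [M] gone, [P] inverts [S'], so the equation can be solved for [E]. Applying [cof3] to the
   result gives [k ^+ 2 * \det S'] times [S'], which recovers [S'] from [E] and dictates [l]. *)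
have EE : E = k *: cof3 S'.
  by rewrite -[LHS]mul1mx -cof3_1 -SP cof3M -mulmxA cE mul_mx_scalar.
have dS : \det S' != 0 by rewrite -unitfE -unitmxE.
have k0 : k != 0.
  apply/eqP => k0; move: E2; rewrite EE k0 scale0r mul0mx => /matrixP/(_ 0 0)/eqP.
  by rewrite !mxE eq_sym oner_eq0.
have a0 : a != 0 by rewrite -sqrf_eq0 a1 oner_eq0.
pose l := a / (k ^+ 2 * \det S').
have l0 : l != 0 by rewrite mulf_neq0 // invr_eq0 mulf_neq0 // sqrf_eq0.
have SE : S' = diag3 l l (l * a).
  have cofE : cof3 E = diag3 a a 1.
    rewrite /E /diag3 cof3E; apply: mx3_eq; try ring.
    - by rewrite -[RHS]mul1r -c1; ring.
    - by rewrite -[RHS]mul1r -c1; ring.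
    - by rewrite -c1; ring.
  have H : cof3 E = (k ^+ 2 * \det S') *: S' by rewrite EE cof3Z cof3_cof3 scalerA.
  have z0 : k ^+ 2 * \det S' != 0 by rewrite mulf_neq0 // sqrf_eq0.
  have -> : S' = (k ^+ 2 * \det S')^-1 *: cof3 E by rewrite H scalerA mulVf // scale1r.
  rewrite cofE /diag3 scalemx3; apply: mx3_eq; rewrite ?mulr0 //.
  - by rewrite mulrC.
  - by rewrite mulrC.
  - by rewrite mulr1 /l (mulrAC a) -expr2 a1 mul1r.
rewrite {}SE in nil *; clear -nil l0 a1 c1.
have gE := nilsoliton_uniq nil (nilsoliton_scaled l0 a1 c1).
rewrite {}gE; clear nil.
exists (metric (diag3 l l (l * a)) 0 (diag3 c c (c * a))); last exact: isometric_refl.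
have sgn (s : R) : s ^+ 2 = 1 -> s = 1 \/ s = -1.
  by move=> /eqP; rewrite sqrf_eq1 => /orP[/eqP|/eqP]; [left|right].
case: (sgn a a1) => ->; case: (sgn c c1) => ->.
- by rewrite !mulr1; constructor 1; exact: Family_i.
- rewrite !(mulr1, mul1r, mulrN, mulNr, opprK); constructor 4.
  have -> : diag3 (-1) (-1) (-1) = - E30 R :> 'M_3 by rewrite /E30; mx3_ring.
  exact: Omitted_30.
- rewrite !(mulr1, mul1r, mulrN, mulNr, opprK); constructor 2; exact: Family_ii.
- rewrite !(mulr1, mul1r, mulrN, mulNr, opprK); constructor 4.
  have -> : diag3 (-1) (-1) 1 = - E21 R :> 'M_3 by rewrite /E21; mx3_ring.
  exact: Omitted_21.
Qed.

(** The first column of [E] is zero, so the scalar [cof3 P *m E] has a zero diagonal entry. *)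
Lemma nilsoliton_degenerate S M (a b gamma : R) :
  nilsoliton (metric S M (diag3 0 a b)) gamma -> gamma = 0.
Proof.
move=> /nilsoliton_metricP[_ _ [P [_ [_ [_ _ _]]]]].
have [p1 [p2 [p3 [p4 [p5 [p6 [p7 [p8 [p9 ->]]]]]]]]] := mx3P (cof3 P).
rewrite /diag3 !mx3_simpl => /mx3_inj[[]]; lra.
Qed.

(** * Rank two: binary forms modulo rotations or boosts *)

Definition plane_form (x y z : R) : 'M[R]_3 := mx3 [:: [:: 0; 0; 0]; [:: 0; x; y]; [:: 0; y; z]].

Lemma nilsoliton_plane_form x y z a b gamma :
  nilsoliton (metric (plane_form x y z) (M2 R) (diag3 0 a b)) gamma -> x * z - y ^+ 2 != 0.
Proof.
move=> nil; apply/eqP => d0.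
have ker u2 u3 : x * u2 + y * u3 = 0 -> y * u2 + z * u3 = 0 -> u2 = 0 /\ u3 = 0.
  move=> h1 h2.
  have [] := @metric_unitP _ _ _ _ _ (cv3 0 u2 u3) (cv3 0 0 0) nil.
  - by rewrite /plane_form /M2 /diag3 !mulmx3_cv add_cv3 cv30; congr cv3; lra.
  - by rewrite /plane_form /M2 /diag3 trmx3 !mulmx3_cv add_cv3 cv30; congr cv3; lra.
  by rewrite cv30 => /cv3_inj[_ -> ->].
(* The columns [(z, -y)] and [(-y, x)] of the adjugate lie in the kernel of a singular form; if both
   vanish, so does the form. *)
have [z0 y0] : z = 0 /\ - y = 0 by apply: ker; [rewrite -d0; ring|ring].
have {}y0 : y = 0 by lra.
have [_ x0] : - y = 0 /\ x = 0 by apply: ker; [ring|rewrite -d0; ring].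
have [] : (1 : R) = 0 /\ (0 : R) = 0 by apply: ker; rewrite ?x0 ?y0; ring.
by move/eqP; rewrite oner_eq0.
Qed.

(** The first diagonal entry of [B] is the determinant of its plane block, so that [M2] is
    multiplied by the square of that determinant, which is 1. The other hypotheses say that the
    cofactor action on [e_5], [e_6] preserves [diag(a, b)]. *)
Lemma plane_form_transform p q r s x y z a b :
  (p * s - q * r) ^+ 2 = 1 -> a * s ^+ 2 + b * q ^+ 2 = a ->
  a * r ^+ 2 + b * p ^+ 2 = b -> a * s * r + b * p * q = 0 ->
  isometric (metric (plane_form x y z) (M2 R) (diag3 0 a b))
    (metric (plane_form (x * p ^+ 2 + 2 * y * p * r + z * r ^+ 2)
                (x * p * q + y * (p * s + q * r) + z * r * s)
                (x * q ^+ 2 + 2 * y * q * s + z * s ^+ 2)) (M2 R) (diag3 0 a b)).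
Proof.
move=> d1 h1 h2 h3.
apply: (@isometric_transform R (mx3 [:: [:: p * s - q * r; 0; 0]; [:: 0; p; q]; [:: 0; r; s]]) 0).
- apply: unitmx3.
  have -> : (p * s - q * r) * (p * s - q * r) + 0 * (q * 0 - 0 * s) + 0 * (0 * r - p * 0) = 1.
    by rewrite -d1; ring.
  exact: oner_neq0.
- by rewrite /plane_form /M2; mx3_ring.
- rewrite /plane_form /M2 /diag3 ?(cof3E, mx3_simpl); apply: mx3_eq; try ring.
  by transitivity ((p * s - q * r) ^+ 2); [rewrite d1|ring].
- pose d2 := (p * s - q * r) ^+ 2.
  rewrite /diag3 ?(cof3E, mx3_simpl); apply: mx3_eq; try ring.
  + transitivity (d2 * (a * s ^+ 2 + b * q ^+ 2)); last by rewrite /d2; ring.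
    by rewrite /d2 d1 h1 mul1r.
  + transitivity (- d2 * (a * s * r + b * p * q)); last by rewrite /d2; ring.
    by rewrite h3 mulr0.
  + transitivity (- d2 * (a * s * r + b * p * q)); last by rewrite /d2; ring.
    by rewrite h3 mulr0.
  + transitivity (d2 * (a * r ^+ 2 + b * p ^+ 2)); last by rewrite /d2; ring.
    by rewrite /d2 d1 h2 mul1r.
- by mx3_ring.
Qed.

Lemma rotation_exists (A B : R) : exists c t,
  c ^+ 2 + t ^+ 2 = 1 /\ A * c * t + B * (c ^+ 2 - t ^+ 2) = 0.
Proof.
have [->|B0] := eqVneq B 0; first by exists 1, 0; split; ring.
pose D := Num.sqrt (A ^+ 2 + 4 * B ^+ 2).
have D2 : D ^+ 2 = A ^+ 2 + 4 * B ^+ 2.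
  by rewrite sqr_sqrtr // addr_ge0 ?sqr_ge0 // mulr_ge0 ?sqr_ge0 ?ler0n.
(* [w] is the tangent [t / c], a root of the equation divided by [c ^+ 2]. *)
pose w := (A + D) / (2 * B).
have wE : B * w ^+ 2 - A * w - B = 0.
  transitivity ((D ^+ 2 - A ^+ 2 - 4 * B ^+ 2) / (4 * B)); first by rewrite /w; field.
  by rewrite D2; field.
pose n := Num.sqrt (1 + w ^+ 2).
have n1 : 0 < 1 + w ^+ 2 by rewrite ltr_pwDl ?ltr01 ?sqr_ge0.
have n2 : n ^+ 2 = 1 + w ^+ 2 by rewrite sqr_sqrtr ?ltW.
have n0 : n != 0 by rewrite -sqrf_eq0 n2 gt_eqF.
exists n^-1, (w / n); split.
  by transitivity ((1 + w ^+ 2) / n ^+ 2); [by field|rewrite n2 divff ?gt_eqF].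
transitivity (- (B * w ^+ 2 - A * w - B) / n ^+ 2); first by field.
by rewrite wE oppr0 mul0r.
Qed.

Lemma boost_exists (A B : R) : B ^+ 2 < A ^+ 2 ->
  exists c t, c ^+ 2 - t ^+ 2 = 1 /\ 2 * c * t * A + (c ^+ 2 + t ^+ 2) * B = 0.
Proof.
wlog A0 : A B / 0 < A => [th BA|BA].
  have [A0|A0|A0] := ltgtP A 0.
  - have [] := th (- A) (- B); rewrite ?oppr_gt0 ?sqrrN //.
    move=> c [t [h1 h2]]; exists c, t; split=> //.
    by rewrite -[RHS]oppr0 -h2; ring.
  - exact: th.
  - by move: BA; rewrite A0 expr0n /= ltNge sqr_ge0.
pose D := Num.sqrt (A ^+ 2 - B ^+ 2).
have D2 : D ^+ 2 = A ^+ 2 - B ^+ 2 by rewrite sqr_sqrtr // subr_ge0 ltW.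
have Dge : 0 <= D := sqrtr_ge0 _.
have AD : 0 < A + D by rewrite ltr_pwDl.
have AD0 : A + D != 0 by rewrite gt_eqF.
(* The root [t / c] of smaller modulus, rationalised so that [B = 0] is allowed; [w ^+ 2 < 1] is
   what permits [c ^+ 2 - t ^+ 2 = 1]. *)
pose w := - B / (A + D).
have wE : B * w ^+ 2 + 2 * A * w + B = 0.
  transitivity (B * (B ^+ 2 - A ^+ 2 + D ^+ 2) / (A + D) ^+ 2); first by rewrite /w; field.
  by rewrite D2; field.
have w1 : 0 < 1 - w ^+ 2.
  rewrite /w expr_div_n sqrrN subr_gt0 ltr_pdivrMr ?exprn_gt0 // mul1r.
  by apply: (lt_le_trans BA); rewrite ler_sqr ?nnegrE ?(ltW A0) ?(ltW AD) // lerDl.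
pose n := Num.sqrt (1 - w ^+ 2).
have n2 : n ^+ 2 = 1 - w ^+ 2 by rewrite sqr_sqrtr ?ltW.
have n0 : n != 0 by rewrite -sqrf_eq0 n2 gt_eqF.
exists n^-1, (w / n); split.
  by transitivity ((1 - w ^+ 2) / n ^+ 2); [by field|rewrite n2 divff ?gt_eqF].
transitivity ((B * w ^+ 2 + 2 * A * w + B) / n ^+ 2); first by field.
by rewrite wE mul0r.
Qed.

End RankThree.

Section PlaneForms.
Variable R : realType.
Implicit Types S M E B C K : 'M[R]_3.

Lemma plane_form_diag x z : plane_form x 0 z = S1 x z :> 'M[R]_3.
Proof. by []. Qed.

Lemma classify_diag_20 x z (b : bool) : x != 0 -> z != 0 ->
  classified (metric (plane_form x 0 z) (M2 R) (diag3 0 ((-1) ^+ b) ((-1) ^+ b))) 0.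
Proof.
move=> x0 z0; exists (metric (S1 x z) (M2 R) ((-1) ^+ b *: E20 R)).
  by constructor 3; exact: Family_iii_20.
rewrite plane_form_diag; have -> : (-1) ^+ b *: E20 R = diag3 0 ((-1) ^+ b) ((-1) ^+ b).
  by rewrite /E20; mx3_ring.
exact: isometric_refl.
Qed.

Lemma rotate_plane_form x y z a : exists x' z',
  isometric (metric (plane_form x y z) (M2 R) (diag3 0 a a))
            (metric (plane_form x' 0 z') (M2 R) (diag3 0 a a)).
Proof.
have [c [t [ct1 ct0]]] := rotation_exists (z - x) y.
have y0 : x * c * - t + y * (c * c + - t * t) + z * t * c = 0 by rewrite -ct0; ring.
do 2!eexists; rewrite -{2}y0; apply: plane_form_transform.
- by rewrite -[RHS](expr1n _ 2) -ct1; congr (_ ^+ 2); ring.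
- by rewrite sqrrN -mulrDr ct1 mulr1.
- by rewrite -mulrDr addrC ct1 mulr1.
- by ring.
Qed.

Lemma boost_plane_form c t x y z x' y' z' a : c ^+ 2 - t ^+ 2 = 1 ->
  x' = x * c ^+ 2 + 2 * y * c * t + z * t ^+ 2 ->
  y' = x * c * t + y * (c * c + t * t) + z * t * c ->
  z' = x * t ^+ 2 + 2 * y * t * c + z * c ^+ 2 ->
  isometric (metric (plane_form x y z) (M2 R) (diag3 0 a (- a)))
            (metric (plane_form x' y' z') (M2 R) (diag3 0 a (- a))).
Proof.
move=> ct1 -> -> ->; apply: plane_form_transform.
- by rewrite -[RHS](expr1n _ 2) -ct1; congr (_ ^+ 2); ring.
- by rewrite -[RHS]mulr1 -ct1; ring.
- by rewrite -[RHS]mulr1 -ct1; ring.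
- by ring.
Qed.

Lemma flip_plane_form x y z a b :
  isometric (metric (plane_form x y z) (M2 R) (diag3 0 a b))
            (metric (plane_form x (- y) z) (M2 R) (diag3 0 a b)).
Proof.
have := @plane_form_transform R 1 0 0 (-1) x y z a b.
have -> : x * 1 ^+ 2 + 2 * y * 1 * 0 + z * 0 ^+ 2 = x by ring.
have -> : x * 1 * 0 + y * (1 * -1 + 0 * 0) + z * 0 * -1 = - y by ring.
have -> : x * 0 ^+ 2 + 2 * y * 0 * -1 + z * (-1) ^+ 2 = z by ring.
by apply; ring.
Qed.

Lemma classify_definite x y z (b : bool) :
  nilsoliton (metric (plane_form x y z) (M2 R) (diag3 0 ((-1) ^+ b) ((-1) ^+ b))) 0 ->
  classified (metric (plane_form x y z) (M2 R) (diag3 0 ((-1) ^+ b) ((-1) ^+ b))) 0.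
Proof.
move=> nil; have [x' [z' iso]] := rotate_plane_form x y z ((-1) ^+ b).
apply: (isometric_classified iso).
have := nilsoliton_plane_form (nilsoliton_transport iso nil).
rewrite expr0n subr0 mulf_eq0 negb_or => /andP[? ?]; exact: classify_diag_20.
Qed.

Lemma classify_diag_11 x z :
  nilsoliton (metric (plane_form x 0 z) (M2 R) (E11 R)) 0 ->
  classified (metric (plane_form x 0 z) (M2 R) (E11 R)) 0.
Proof.
move=> /nilsoliton_plane_form; rewrite expr0n subr0 mulf_eq0 negb_or => /andP[x0 z0].
exists (metric (S1 x z) (M2 R) (E11 R)); last exact: isometric_refl.
by constructor 3; exact: Family_iii_11_1.
Qed.

(* On the light cone [(x + z)^2 = 4 y^2] the boost with rapidity [ln w] scales [y] by
   [w^2] or [w^-2] and fixes [x - z], so [y] can be made equal to [|x - z| / 2]. *)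
Lemma boost_parabolic x y z : 0 < y -> (x + z) ^+ 2 = 4 * y ^+ 2 ->
  x * z - y ^+ 2 != 0 ->
  let m := (x - z) / 2 in exists k, (k = 1 \/ k = -1) /\
  isometric (metric (plane_form x y z) (M2 R) (E11 R))
    (metric (plane_form (k * `|m| + m) `|m| (k * `|m| - m)) (M2 R) (E11 R)).
Proof.
move=> y0 pE d0 m.
have m0 : m != 0.
  apply: contraNneq d0 => mz; apply/eqP.
  have -> : x * z - y ^+ 2 = ((x + z) ^+ 2 - 4 * y ^+ 2) / 4 - m ^+ 2 by rewrite /m; field.
  by rewrite pE subrr mz expr0n /= mul0r subrr.
have yn0 : y != 0 by rewrite gt_eqF.
have mp : 0 < `|m| / y by rewrite divr_gt0 // normr_gt0.
pose w := Num.sqrt (`|m| / y).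
have w2 : w ^+ 2 = `|m| / y by rewrite sqr_sqrtr // ltW.
have w0 : w != 0 by rewrite -sqrf_eq0 w2 gt_eqF.
have mE : `|m| = w ^+ 2 * y by rewrite w2 divfK.
have /orP[/eqP xz|/eqP xz] : (x + z == 2 * y) || (x + z == - (2 * y)).
  by rewrite -eqf_sqr pE exprMn -natrX.
- exists 1; split; first by left.
  have ct1 : ((w + w^-1) / 2) ^+ 2 - ((w - w^-1) / 2) ^+ 2 = 1 by field.
  have zE : z = 2 * y - x by rewrite -xz; ring.
  by apply: (boost_plane_form _ ct1); rewrite mE /m zE; field.
- exists (-1); split; first by right.
  have ct1 : ((w + w^-1) / 2) ^+ 2 - ((w^-1 - w) / 2) ^+ 2 = 1 by field.
  have zE : z = - (2 * y) - x by rewrite -xz; ring.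
  by apply: (boost_plane_form _ ct1); rewrite mE /m zE; field.
Qed.

(** [(x + z)^2 - (2 y)^2] is the discriminant of the characteristic polynomial of [E11^-1 S] on the
    plane. Positive: a boost diagonalises. Negative: the eigenvalues are not real, which is the
    omitted family. Zero: a double eigenvalue, where the form is diagonal or leads to [S2] or
    [S3]. *)
Lemma classify_indefinite x y z :
  nilsoliton (metric (plane_form x y z) (M2 R) (E11 R)) 0 ->
  classified (metric (plane_form x y z) (M2 R) (E11 R)) 0.
Proof.
move=> nil.
have [lt|lt|eq] := ltgtP ((2 * y) ^+ 2) ((x + z) ^+ 2).
- have [c [t [ct1 ct0]]] := boost_exists lt.
  have iso := @boost_plane_form c t x y z _ _ _ 1 ct1 erefl erefl erefl.
  have y0 : x * c * t + y * (c * c + t * t) + z * t * c = 0 by move: ct0; lra.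
  rewrite y0 in iso; apply: (isometric_classified iso).
  exact/classify_diag_11/(nilsoliton_transport iso).
- have [c [t [ct1 ct0]]] := boost_exists lt.
  have iso := @boost_plane_form c t x y z _ _ _ 1 ct1 erefl erefl erefl; apply: (isometric_classified iso).
  have {nil iso} := nilsoliton_transport iso nil.
  set X := x * c ^+ 2 + _ + _; set Y := x * c * t + _ + _; set Z := x * t ^+ 2 + _ + _.
  (* In this case a boost can annihilate the sum of the diagonal entries instead of the off-diagonal
     one. *)
  have -> : Z = - X by rewrite /Z /X; move: ct0; lra.
  have [->|Y0] := eqVneq Y 0; first exact: classify_diag_11.
  move=> _; exists (metric (mx3 [:: [:: 0; 0; 0]; [:: 0; X; Y]; [:: 0; Y; - X]]) (M2 R) (E11 R)).
    by constructor 4; exact: Omitted_11.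
  exact: isometric_refl.
wlog y0 : y nil eq / 0 < y => [th|].
  have [y0|y0|y0] := ltgtP y 0.
  - have iso := flip_plane_form x y z 1 (-1); apply: (isometric_classified iso).
    apply: (th _ (nilsoliton_transport iso nil)); last by rewrite oppr_gt0.
    by rewrite mulrN sqrrN.
  - exact: th.
  - by move: nil; rewrite y0; exact: classify_diag_11.
have d0 := nilsoliton_plane_form nil.
have pE : (x + z) ^+ 2 = 4 * y ^+ 2 by rewrite -eq; ring.
have [k [k1 iso]] := boost_parabolic y0 pE d0.
apply: (isometric_classified iso); have {nil iso} := nilsoliton_transport iso nil.
move: (_ / 2) => m /nilsoliton_plane_form {}d0.
have m0 : m != 0.
  by apply: contraNneq d0 => ->; rewrite normr0 mulr0 addr0 subr0 mul0r expr0n subrr.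
have S2E s : s != 0 -> classified (metric (plane_form s (`|s| / 2) 0) (M2 R) (E11 R)) 0.
  move=> s0; exists (metric (S2 s) (M2 R) (E11 R)); last exact: isometric_refl.
  by constructor 3; exact: Family_iii_11_2.
have S3E s : s != 0 -> classified (metric (plane_form 0 (`|s| / 2) s) (M2 R) (E11 R)) 0.
  move=> s0; exists (metric (S3 s) (M2 R) (E11 R)); last exact: isometric_refl.
  by constructor 3; exact: Family_iii_11_3.
have m20 : 2 * m != 0 by rewrite mulf_neq0 // pnatr_eq0.
have mm20 : - (2 * m) != 0 by rewrite oppr_eq0.
have n2 : `|m| = `|2 * m| / 2 by rewrite normrM ger0_norm ?ler0n //; field.
have n2' : `|m| = `|- (2 * m)| / 2 by rewrite normrN.
(* Exactly one of the two diagonal entries vanishes. The other is [2 m] or [- (2 m)], which is why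
   the off-diagonal entry is half its absolute value. *)
have [mp|mp] := ltP 0 m; case: k1 => ->.
- have -> : 1 * `|m| - m = 0 by rewrite gtr0_norm //; ring.
  have -> : 1 * `|m| + m = 2 * m by rewrite gtr0_norm //; ring.
  by rewrite n2; exact: S2E.
- have -> : -1 * `|m| - m = - (2 * m) by rewrite gtr0_norm //; ring.
  have -> : -1 * `|m| + m = 0 by rewrite gtr0_norm //; ring.
  by rewrite n2'; exact: S3E.
- have -> : 1 * `|m| - m = - (2 * m) by rewrite ler0_norm //; ring.
  have -> : 1 * `|m| + m = 0 by rewrite ler0_norm //; ring.
  by rewrite n2'; exact: S3E.
- have -> : -1 * `|m| - m = 0 by rewrite ler0_norm //; ring.
  have -> : -1 * `|m| + m = 2 * m by rewrite ler0_norm //; ring.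
  by rewrite n2; exact: S2E.
Qed.

End PlaneForms.

(** * Central forms of rank at most two *)

Section LowRank.
Variable R : realType.
Implicit Types S M E B C K : 'M[R]_3.

(* The column [m] of [M] satisfies [P m = 0] and [S P = 1 - m q^T] with [q m = 1], so
   [cof S cof P = q m^T]. As [cof P E = 0], only the first column of [cof P] is
   nonzero, which forces [m] to be a multiple of [e_1]. *)
Lemma rank2_column_axis S (m1 m2 m3 a b gamma : R) : a != 0 -> b != 0 ->
  let M := mx3 [:: [:: m1; 0; 0]; [:: m2; 0; 0]; [:: m3; 0; 0]] in
  nilsoliton (metric S M (diag3 0 a b)) gamma -> [/\ m1 != 0, m2 = 0 & m3 = 0].
Proof.
move=> a0 b0 M nil.
have m_neq0 : ~ [/\ m1 = 0, m2 = 0 & m3 = 0].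
  move=> [h1 h2 h3]; have [] := @metric_unitP _ _ _ _ _ 0 (cv3 1 0 0) nil.
  - by rewrite mulmx0 add0r /M h1 h2 h3 mulmx3_cv cv30; congr cv3; ring.
  - by rewrite mulmx0 add0r /diag3 mulmx3_cv cv30; congr cv3; ring.
  by rewrite cv30 => _ /cv3_inj[/eqP]; rewrite oner_eq0.
have g0 := nilsoliton_degenerate nil.
have [_ _ [P [Q [T [PT _ [e1 _ e3 _] cE]]]]] := (nilsoliton_metricP _ _ _ _).1 nil.
have [q1 [r1 [t1 [q2 [r2 [t2 [q3 [r3 [t3 QE]]]]]]]]] := mx3P Q.
have PM : P *m M = 0 /\ [/\ [/\ r1 = 0, r2 = 0 & r3 = 0] & [/\ t1 = 0, t2 = 0 & t3 = 0]].
  have [p1 [p2 [p3 [p4 [p5 [p6 PE]]]]]] := sym3P PT.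
  move: e3; rewrite PE QE /M /diag3 !mx3_simpl.
  move=> /mx3_inj[[h1 h2 h3] [h4 h5 h6] [h7 h8 h9]].
  have za u : a * u = 0 -> u = 0 by move/eqP; rewrite mulf_eq0 (negbTE a0) => /eqP.
  have zb u : b * u = 0 -> u = 0 by move/eqP; rewrite mulf_eq0 (negbTE b0) => /eqP.
  split; first by apply: mx3_eq; lra.
  by split; split; [apply: za|apply: za|apply: za|apply: zb|apply: zb|apply: zb]; lra.
case: PM => PM [[r10 r20 r30] [t10 t20 t30]].
rewrite {}r10 {}r20 {}r30 {}t10 {}t20 {}t30 in QE.
pose s := q1 * m1 + q2 * m2 + q3 * m3.
have hs : [/\ m1 * s = m1, m2 * s = m2 & m3 * s = m3].
  have := congr1 (mulmx^~ M) e1; rewrite mulmxDl mul1mx -mulmxA PM mulmx0 add0r.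
  rewrite QE /M !mx3_simpl => /mx3_inj[[h1 _ _] [h2 _ _] [h3 _ _]].
  by rewrite /s; split; [rewrite -[RHS]h1|rewrite -[RHS]h2|rewrite -[RHS]h3]; ring.
have s1 : s = 1.
  apply/eqP; apply: contraT => sn1; case: m_neq0; case: hs => h1 h2 h3.
  have z u : u * s = u -> u = 0.
    move=> hu; have : u * (s - 1) = 0 by rewrite mulrBr hu mulr1 subrr.
    by move=> /eqP; rewrite mulf_eq0 subr_eq0 (negbTE sn1) orbF => /eqP.
  by split; apply: z.
have cSP : cof3 S *m cof3 P = cof3 (1%:M - M *m Q^T) by rewrite -cof3M -e1 addrK.
have [c1 [c2 [c3 [c4 [c5 [c6 [c7 [c8 [c9 PE]]]]]]]]] := mx3P (cof3 P).
have [d1 [d2 [d3 [d4 [d5 [d6 [d7 [d8 [d9 SE]]]]]]]]] := mx3P (cof3 S).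
have cP : [/\ [/\ c2 = 0, c5 = 0 & c8 = 0] & [/\ c3 = 0, c6 = 0 & c9 = 0]].
  move: cE; rewrite g0 PE /diag3 !mx3_simpl.
  move=> /mx3_inj[[h1 h2 h3] [h4 h5 h6] [h7 h8 h9]].
  have za u : u * a = 0 -> u = 0 by move/eqP; rewrite mulf_eq0 (negbTE a0) orbF => /eqP.
  have zb u : u * b = 0 -> u = 0 by move/eqP; rewrite mulf_eq0 (negbTE b0) orbF => /eqP.
  by split; split; [apply: za|apply: za|apply: za|apply: zb|apply: zb|apply: zb]; lra.
case: cP => [[c20 c50 c80] [c30 c60 c90]].
move: cSP; rewrite PE SE c20 c50 c80 c30 c60 c90 QE /M scalar_mx3 /diag3.
rewrite ?(trmx3, mulmx3, oppmx3, addmx3) cof3E.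
move=> /mx3_inj[[_ h2 h3] [_ h5 h6] [_ h8 h9]].
(* The second column of [(1 - s) + q m^T] vanishes; pairing it with [m] gives [m2 * s = 0]. *)
have m20 : m2 = 0.
  have e : m2 * s = 0.
    have -> : m2 * s = m1 * (q1 * m2) + m2 * (1 - s + q2 * m2) + m3 * (q3 * m2) - m2 * (1 - s).
      by rewrite /s; ring.
    rewrite s1 subrr mulr0 subr0.
    have -> : q1 * m2 = 0 by lra.
    have -> : q3 * m2 = 0 by lra.
    have -> : 0 + q2 * m2 = 0 by move: s1; rewrite /s; lra.
    ring.
  by rewrite s1 mulr1 in e.
have m30 : m3 = 0.
  have e : m3 * s = 0.
    have -> : m3 * s = m1 * (q1 * m3) + m2 * (q2 * m3) + m3 * (1 - s + q3 * m3) - m3 * (1 - s).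
      by rewrite /s; ring.
    rewrite s1 subrr mulr0 subr0.
    have -> : q1 * m3 = 0 by lra.
    have -> : q2 * m3 = 0 by lra.
    have -> : 0 + q3 * m3 = 0 by move: s1; rewrite /s; lra.
    ring.
  by rewrite s1 mulr1 in e.
by split=> //; apply/eqP => m10; apply: m_neq0.
Qed.

Lemma rank2_reduce S M (a b gamma : R) : a ^+ 2 = 1 -> b ^+ 2 = 1 ->
  nilsoliton (metric S M (diag3 0 a b)) gamma -> exists x y z,
  isometric (metric S M (diag3 0 a b)) (metric (plane_form x y z) (M2 R) (diag3 0 a b)).
Proof.
move=> a1 b1 nil; set E := diag3 0 a b.
have a0 : a != 0 by rewrite -sqrf_eq0 a1 oner_eq0.
have b0 : b != 0 by rewrite -sqrf_eq0 b1 oner_eq0.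
have ET : E^T = E by rewrite /E; mx3_ring.
have [m1 [n1 [k1 [m2 [n2 [k2 [m3 [n3 [k3 ME]]]]]]]]] := mx3P M.
have [S' iso] : exists S', isometric (metric S M E)
   (metric S' (mx3 [:: [:: m1; 0; 0]; [:: m2; 0; 0]; [:: m3; 0; 0]]) E).
  apply: (@isometric_shear R (- (E *m M^T))) => //.
  rewrite linearN /= trmx_mul trmxK ET mulNmx -mulmxA ME.
  have -> : E *m E = diag3 0 1 1.
    rewrite /E /diag3 !mx3_simpl; apply: mx3_eq; try ring.
    + by rewrite -a1; ring.
    + by rewrite -b1; ring.
  mx3_ring.
have {}nil := nilsoliton_transport iso nil.
have [m0 m20 m30] := rank2_column_axis a0 b0 nil.
rewrite m20 m30 in iso nil.
have [ST _ _] := (nilsoliton_metricP _ _ _ _).1 nil.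
have [s1 [s2 [s3 [s4 [s5 [s6 SE]]]]]] := sym3P ST.
exists (s4 / m1 ^+ 2), (s5 / m1 ^+ 2), (s6 / m1 ^+ 2).
apply: (isometric_trans iso).
(* The cofactor of this [B] is [diag(m1^-2, 1, 1)]: it fixes [E] and scales [m1] to 1. The first row
   of [C] clears the first row of [S], halved on the diagonal where it enters twice; [E] annihilates
   that axis, so [M] is not disturbed. *)
apply: (@isometric_transform R (diag3 m1 m1^-1 m1^-1)
  (mx3 [:: [:: - s1 / 2; - s2 / m1 ^+ 2; - s3 / m1 ^+ 2]; [:: 0; 0; 0]; [:: 0; 0; 0]])) => //.
- apply: unitmx3; rewrite !(mulr0, mul0r, addr0, subr0).
  by rewrite !mulf_neq0 ?invr_eq0.
- by rewrite SE /plane_form /E /diag3 ?(cof3E, mx3_simpl); apply: mx3_eq; field.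
- by rewrite /M2 /E /diag3 ?(cof3E, mx3_simpl); apply: mx3_eq; field.
- by rewrite /E /diag3 ?(cof3E, mx3_simpl); apply: mx3_eq; field.
Qed.

(** * Ranks zero and one *)

Lemma classify_rank0 S M gamma :
  nilsoliton (metric S M 0) gamma -> classified (metric S M 0) gamma.
Proof.
move=> nil.
have [ST _ [P [Q [T [_ _ [_ _ _ e4] _]]]]] := (nilsoliton_metricP _ _ _ _).1 nil.
have -> : gamma = 0 by apply: (@nilsoliton_degenerate R S M 0 0); rewrite -const_mx3.
have uM : M \in unitmx.
  by rewrite -unitmx_tr; move: e4; rewrite mul0mx addr0 => /mulmx1_unit[].
exists (metric 0 M 0); first by constructor 4; exact: Omitted_00.
(* [M C] and its transpose each contribute [- S / 2]. *)
apply: (@isometric_transform R 1%:M (- (2^-1 *: (invmx M *m S)))).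
- exact: unitmx1.
- rewrite !trmx1 !mul1mx !mulmx1 mulmx0 mul0mx addr0.
  have -> : (- (2^-1 *: (invmx M *m S)))^T = - (2^-1 *: (S *m (invmx M)^T)).
    by rewrite linearN linearZ /= trmx_mul ST.
  rewrite mulmxN -scalemxAr mulKVmx // mulNmx -scalemxAl -mulmxA -trmx_mul mulmxV // trmx1 mulmx1.
  rewrite -!scaleNr -[X in X + _ + _]scale1r -!scalerDl.
  have -> : 1 - 2^-1 - 2^-1 = 0 :> R by field.
  by rewrite scale0r.
- by rewrite trmx1 mul1mx mulmx0 addr0 cof3_1 mulmx1.
- by rewrite mulmx0 mul0mx.
- by rewrite trmx0.
Qed.

(** A linear relation between the first two columns of [M] gives a vector in the span of [e_4],
    [e_5] killed by [M] and by [E], hence in the kernel of the metric. *)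
Lemma rank1_columns S m11 m12 m13 m21 m22 m23 m31 m32 m33 h gamma :
  nilsoliton (metric S (mx3 [:: [:: m11; m12; m13]; [:: m21; m22; m23];
    [:: m31; m32; m33]]) (diag3 0 0 h)) gamma ->
  m21 * m32 - m31 * m22 = 0 -> m31 * m12 - m11 * m32 = 0 ->
  m11 * m22 - m21 * m12 = 0 -> False.
Proof.
move=> nil h1 h2 h3.
have ker v1 v2 : m11 * v1 + m12 * v2 = 0 -> m21 * v1 + m22 * v2 = 0 ->
    m31 * v1 + m32 * v2 = 0 -> v1 = 0 /\ v2 = 0.
  move=> e1 e2 e3; have [] := @metric_unitP _ _ _ _ _ 0 (cv3 v1 v2 0) nil.
  - by rewrite mulmx0 add0r mulmx3_cv cv30; congr cv3; lra.
  - by rewrite mulmx0 add0r /diag3 mulmx3_cv cv30; congr cv3; ring.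
  by rewrite cv30 => _ /cv3_inj[-> ->].
have [a1 b1] : m12 = 0 /\ - m11 = 0 by apply: ker; lra.
have [a2 b2] : m22 = 0 /\ - m21 = 0 by apply: ker; lra.
have [a3 b3] : m32 = 0 /\ - m31 = 0 by apply: ker; lra.
have [] : (1 : R) = 0 /\ (0 : R) = 0 by apply: ker; lra.
by move/eqP; rewrite oner_eq0.
Qed.

Lemma rank1_kill_column S m11 m12 m13 m21 m22 m23 m31 m32 m33 h : h != 0 ->
  exists S', isometric
  (metric S (mx3 [:: [:: m11; m12; m13]; [:: m21; m22; m23];
    [:: m31; m32; m33]]) (diag3 0 0 h))
  (metric S' (mx3 [:: [:: m11; m12; 0]; [:: m21; m22; 0];
    [:: m31; m32; 0]]) (diag3 0 0 h)).
Proof.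
move=> h0; apply: (@isometric_shear R (mx3 [:: [:: 0; 0; 0]; [:: 0; 0; 0];
  [:: - m13 / h; - m23 / h; - m33 / h]])); first by mx3_ring.
by rewrite /diag3 !mx3_simpl; apply: mx3_eq; field.
Qed.

Lemma unit_scale (x : R) : x != 0 -> exists k (b : bool), k != 0 /\ k ^+ 2 * x = (-1) ^+ b.
Proof.
move=> x0; have n0 : 0 < `|x| by rewrite normr_gt0.
exists (Num.sqrt `|x|)^-1, (x < 0); split.
  by rewrite invr_eq0 sqrtr_eq0 -ltNge.
rewrite exprVn sqr_sqrtr ?ltW // [X in _ * X]numEsg mulrC mulfK ?gt_eqF //.
have [xs|xs|xs] := ltgtP x 0; first by rewrite ltr0_sg.
  by rewrite gtr0_sg.
by rewrite xs eqxx in x0.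
Qed.

Lemma classify_rank1_flat S p q r s (c : bool) gamma :
  nilsoliton (metric S (mx3 [:: [:: p; q; 0]; [:: r; s; 0]; [:: 0; 0; 0]])
     (diag3 0 0 ((-1) ^+ c))) gamma ->
  classified (metric S (mx3 [:: [:: p; q; 0]; [:: r; s; 0]; [:: 0; 0; 0]])
     (diag3 0 0 ((-1) ^+ c))) gamma.
Proof.
move=> nil; have g0 := nilsoliton_degenerate nil; rewrite {}g0 in nil *.
have d0 : p * s - q * r != 0.
  by apply/eqP => d0; apply: (rank1_columns nil); lra.
have [ST _ _] := (nilsoliton_metricP _ _ _ _).1 nil.
have [s1 [s2 [s3 [s4 [s5 [s6 SE]]]]]] := sym3P ST.
have iso : isometric (metric S (mx3 [:: [:: p; q; 0]; [:: r; s; 0]; [:: 0; 0; 0]])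
     (diag3 0 0 ((-1) ^+ c)))
   (metric (diag3 0 0 s6) (mx3 [:: [:: p; q; 0]; [:: r; s; 0]; [:: 0; 0; 0]])
     (diag3 0 0 ((-1) ^+ c))).
  (* The upper 2x2 block of [M] is invertible, so the first two rows of [M C] are arbitrary and
     clear all of [S] except its last diagonal entry. The zero last row of [C] gives [C^T E = 0]. *)
  apply: (@isometric_transform R 1%:M (mx3 [::
    [:: (- s * s1 / 2) / (p * s - q * r); (- s * s2 + q * s4 / 2) / (p * s - q * r);
        (- s * s3 + q * s5) / (p * s - q * r)];
    [:: (r * s1 / 2) / (p * s - q * r); (r * s2 - p * s4 / 2) / (p * s - q * r);
        (r * s3 - p * s5) / (p * s - q * r)];
    [:: 0; 0; 0]])); last by mx3_ring.
  - exact: unitmx1.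
  - by rewrite SE /diag3 ?(cof3E, mx3_simpl); apply: mx3_eq; field.
  - by rewrite /diag3 ?(cof3E, mx3_simpl); apply: mx3_eq; field.
  - by mx3_ring.
apply: (isometric_classified iso); have {iso}nil := nilsoliton_transport iso nil.
have s60 : s6 != 0.
  apply/eqP => z; have [] := @metric_unitP _ _ _ _ _ (cv3 0 0 1) 0 nil.
  - by rewrite mulmx0 addr0 z /diag3 mulmx3_cv cv30; congr cv3; ring.
  - by rewrite mulmx0 addr0 trmx3 mulmx3_cv cv30; congr cv3; ring.
  by rewrite cv30 => /cv3_inj[_ _ /eqP]; rewrite oner_eq0.
have [k [b [k0 kE]]] := unit_scale s60.
exists (metric ((-1) ^+ b *: E10 R)
  (mx3 [:: [:: k * p; k * q; 0]; [:: k * r; k * s; 0]; [:: 0; 0; 0]])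
  ((-1) ^+ c *: E10 R)).
  constructor 4; apply: Omitted_10_flat.
  have -> : k * p * (k * s) - k * q * (k * r) = k * k * (p * s - q * r) by ring.
  by rewrite !mulf_neq0.
apply: (@isometric_transform R (diag3 1 1 k) 0); last by mx3_ring.
- by apply: unitmx3; rewrite !(mulr0, mul0r, addr0, subr0, mul1r).
- by rewrite /E10 -kE; mx3_ring.
- by mx3_ring.
- by rewrite /E10; mx3_ring.
Qed.

(* [M1] up to a shear moving the annihilator [e_2 - e_3] of its columns to [e_2]. *)
Lemma isometric_M1 (l t h : R) : h != 0 ->
  isometric (metric (diag3 0 0 t) (M1 l) (diag3 0 0 h))
   (metric (diag3 0 t 0) (mx3 [:: [:: 0; l; 0]; [:: 0; 0; 0]; [:: 1; 0; 0]]) (diag3 0 0 h)).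
Proof.
move=> h0.
apply: (@isometric_transform R (mx3 [:: [:: 1; 0; 0]; [:: 0; 1; 0]; [:: 0; -1; 1]])
  (mx3 [:: [:: 0; t; - t / 2]; [:: - l / (2 * h); 0; 0]; [:: - l / h; 0; 0]]));
  last by mx3_ring.
- by apply: unitmx3; rewrite !(mulr0, mul0r, addr0, subr0, mul1r) oner_eq0.
- by rewrite /M1 /diag3 ?(cof3E, mx3_simpl); apply: mx3_eq; field.
- by rewrite /M1 /diag3 ?(cof3E, mx3_simpl); apply: mx3_eq; field.
- by mx3_ring.
Qed.

Lemma rank1_kill_gen S (p q r s h gamma : R) :
  let M := mx3 [:: [:: p; q; 0]; [:: 0; 0; 0]; [:: r; s; 0]] in
  nilsoliton (metric S M (diag3 0 0 h)) gamma ->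
  exists2 t, t != 0 & isometric (metric S M (diag3 0 0 h)) (metric (diag3 0 t 0) M (diag3 0 0 h)).
Proof.
move=> M nil.
have d0 : p * s - q * r != 0.
  by apply/eqP => d0; apply: (rank1_columns nil); lra.
have [ST _ _] := (nilsoliton_metricP _ _ _ _).1 nil.
have [s1 [s2 [s3 [s4 [s5 [s6 SE]]]]]] := sym3P ST.
have iso : isometric (metric S M (diag3 0 0 h)) (metric (diag3 0 s4 0) M (diag3 0 0 h)).
  apply: (@isometric_transform R 1%:M (mx3 [::
    [:: (- s * s1 / 2) / (p * s - q * r); (- s * s2 + q * s5) / (p * s - q * r);
        (- s * s3 + q * s6 / 2) / (p * s - q * r)];
    [:: (r * s1 / 2) / (p * s - q * r); (r * s2 - p * s5) / (p * s - q * r);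
        (r * s3 - p * s6 / 2) / (p * s - q * r)];
    [:: 0; 0; 0]])); last by mx3_ring.
  - exact: unitmx1.
  - by rewrite SE /M /diag3 ?(cof3E, mx3_simpl); apply: mx3_eq; field.
  - by rewrite /M /diag3 ?(cof3E, mx3_simpl); apply: mx3_eq; field.
  - by mx3_ring.
exists s4 => //; have {iso}nil := nilsoliton_transport iso nil.
apply/eqP => z; have [] := @metric_unitP _ _ _ _ _ (cv3 0 1 0) 0 nil.
- by rewrite mulmx0 addr0 z /diag3 mulmx3_cv cv30; congr cv3; ring.
- by rewrite mulmx0 addr0 trmx3 mulmx3_cv cv30; congr cv3; ring.
by rewrite cv30 => /cv3_inj[_ /eqP]; rewrite oner_eq0.
Qed.

Lemma rank1_scale (f n e t p q r s h : R) : f != 0 -> n != 0 -> e != 0 ->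
  isometric (metric (diag3 0 t 0) (mx3 [:: [:: p; q; 0]; [:: 0; 0; 0]; [:: r; s; 0]])
    (diag3 0 0 h))
   (metric (diag3 0 (n ^+ 2 * t) 0)
    (mx3 [:: [:: f * n * e * p; f ^+ 2 * e * q; 0]; [:: 0; 0; 0];
             [:: e ^+ 2 * n * r; e ^+ 2 * f * s; 0]])
    (diag3 0 0 (f ^+ 2 * (n ^+ 2 * h)))).
Proof.
move=> f0 n0 e0; apply: (@isometric_transform R (diag3 f n e) 0); last by mx3_ring.
- by apply: unitmx3; rewrite !(mulr0, mul0r, addr0, subr0) !mulf_neq0.
- by mx3_ring.
- by mx3_ring.
- by mx3_ring.
Qed.

Lemma classify_rank1_M1 S q r h : h != 0 ->
  let M := mx3 [:: [:: 0; q; 0]; [:: 0; 0; 0]; [:: r; 0; 0]] in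
  nilsoliton (metric S M (diag3 0 0 h)) 0 -> classified (metric S M (diag3 0 0 h)) 0.
Proof.
move=> h0 M nil; have [t t0 iso] := rank1_kill_gen nil.
apply: (isometric_classified iso) => {iso}.
have q0 : q != 0 by apply/eqP => q0; apply: (rank1_columns nil); rewrite ?q0; ring.
have r0 : r != 0 by apply/eqP => r0; apply: (rank1_columns nil); rewrite ?r0; ring.
(* Only [n ^+ 2] matters for [t], so the sign of [n] is free to make [n * r] positive; then
   [e ^+ 2 * n * r = 1] has a solution [e]. *)
have [n [b [n0 nr nE]]] : exists n (b : bool), [/\ n != 0, 0 < n * r & n ^+ 2 * t = (-1) ^+ b].
  have [n [b [n0 nE]]] := unit_scale t0.
  have [nr|nr|nr] := ltgtP (n * r) 0.
  - by exists (- n), b; rewrite oppr_eq0 mulNr oppr_gt0 sqrrN.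
  - by exists n, b.
  - by move/eqP: nr; rewrite mulf_eq0 (negbTE n0) (negbTE r0).
have nh0 : n ^+ 2 * h != 0 by rewrite mulf_neq0 // sqrf_eq0.
have [f [c [f0 fE]]] := unit_scale nh0.
pose e := (Num.sqrt (n * r))^-1.
have e0 : e != 0 by rewrite invr_eq0 sqrtr_eq0 -ltNge.
have eE : e ^+ 2 * n * r = 1.
  by rewrite -mulrA exprVn sqr_sqrtr ?ltW // mulVf ?gt_eqF.
have := rank1_scale t 0 q r 0 h f0 n0 e0; rewrite nE fE eE !mulr0 => iso.
apply: (isometric_classified iso) => {iso}.
have c0 : (-1) ^+ c != 0 :> R by rewrite signr_eq0.
have iso := isometric_sym (isometric_M1 (f ^+ 2 * e * q) ((-1) ^+ b) c0).
apply: (isometric_classified iso) => {iso}.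
exists (metric ((-1) ^+ b *: E10 R) (M1 (f ^+ 2 * e * q)) ((-1) ^+ c *: E10 R)).
  by constructor 3; apply: Family_iii_10; rewrite !mulf_neq0 ?sqrf_eq0.
have zE (z : R) : z *: E10 R = diag3 0 0 z by rewrite /E10; mx3_ring.
by rewrite !zE; exact: isometric_refl.
Qed.

Lemma classify_rank1_omitted S p s h : h != 0 ->
  let M := mx3 [:: [:: p; 0; 0]; [:: 0; 0; 0]; [:: 0; s; 0]] in
  nilsoliton (metric S M (diag3 0 0 h)) 0 -> classified (metric S M (diag3 0 0 h)) 0.
Proof.
move=> h0 M nil; have [t t0 iso] := rank1_kill_gen nil.
apply: (isometric_classified iso) => {iso}.
have p0 : p != 0 by apply/eqP => p0; apply: (rank1_columns nil); rewrite ?p0; ring.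
have s0 : s != 0 by apply/eqP => s0; apply: (rank1_columns nil); rewrite ?s0; ring.
have [n [b [n0 nE]]] := unit_scale t0.
have nh0 : n ^+ 2 * h != 0 by rewrite mulf_neq0 // sqrf_eq0.
have [f [c [f0 fE]]] := unit_scale nh0.
pose e := (f * n * p)^-1.
have e0 : e != 0 by rewrite invr_eq0 !mulf_neq0.
have eE : f * n * e * p = 1 by rewrite /e; field; rewrite f0 n0 p0.
have := rank1_scale t p 0 0 s h f0 n0 e0; rewrite nE fE eE !mulr0 => iso.
apply: (isometric_classified iso) => {iso}.
exists (metric ((-1) ^+ b *: diag3 0 1 0)
   (mx3 [:: [:: 1; 0; 0]; [:: 0; 0; 0]; [:: 0; e ^+ 2 * f * s; 0]]) ((-1) ^+ c *: E10 R)).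
  by constructor 4; apply: Omitted_10; rewrite !mulf_neq0 ?sqrf_eq0.
have -> : (-1) ^+ c *: E10 R = diag3 0 0 ((-1) ^+ c) by rewrite /E10; mx3_ring.
have -> : (-1) ^+ b *: diag3 0 1 0 = diag3 0 ((-1) ^+ b) 0 :> 'M[R]_3 by mx3_ring.
exact: isometric_refl.
Qed.

(** Here [e_2] annihilates the columns of [M], and [e_3] spans modulo the centre the line whose
    brackets form the kernel of [E]. Their bracket [e_4] is thus distinguished, and its product [r]
    with [e_3] decides between the omitted family and [M1]. *)
Lemma classify_rank1_row S p q r s h : h != 0 ->
  let M := mx3 [:: [:: p; q; 0]; [:: 0; 0; 0]; [:: r; s; 0]] in
  nilsoliton (metric S M (diag3 0 0 h)) 0 -> classified (metric S M (diag3 0 0 h)) 0.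
Proof.
move=> h0 M nil.
have d0 : p * s - q * r != 0.
  by apply/eqP => d0; apply: (rank1_columns nil); lra.
have [r0|r0] := eqVneq r 0.
  have s0 : s != 0 by apply: contraNneq d0 => ->; rewrite r0 !mulr0 subr0.
  have [S' iso] : exists S', isometric (metric S M (diag3 0 0 h))
     (metric S' (mx3 [:: [:: p; 0; 0]; [:: 0; 0; 0]; [:: 0; s; 0]]) (diag3 0 0 h)).
    eexists; apply: (@isometric_transform R
      (mx3 [:: [:: 1; 0; 0]; [:: 0; 1; 0]; [:: - q / s; 0; 1]])
      (mx3 [:: [:: 0; 0; 0]; [:: 0; 0; 0]; [:: - q * p / (s * h); 0; 0]]));
      [|reflexivity| | |by mx3_ring].
    + by apply: unitmx3; rewrite !(mulr0, mul0r, addr0, subr0, mul1r) oner_eq0.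
    + by rewrite /M r0 /diag3 ?(cof3E, mx3_simpl); apply: mx3_eq; field; rewrite ?s0 ?h0.
    + by rewrite /diag3 ?(cof3E, mx3_simpl); apply: mx3_eq; field.
  apply: (isometric_classified iso).
  exact: (classify_rank1_omitted h0 (nilsoliton_transport iso nil)).
have [S' iso] : exists S', isometric (metric S M (diag3 0 0 h))
   (metric S' (mx3 [:: [:: 0; q - p * s / r; 0]; [:: 0; 0; 0]; [:: r; 0; 0]]) (diag3 0 0 h)).
  eexists; apply: (@isometric_transform R
      (mx3 [:: [:: 1; 0; 0]; [:: s / r; 1; 0]; [:: - p / r; 0; 1]])
      (mx3 [:: [:: 0; 0; 0]; [:: 0; 0; 0]; [:: 0; 0; - p / h]]));
      [|reflexivity| | |by mx3_ring].
  + by apply: unitmx3; rewrite !(mulr0, mul0r, addr0, subr0, mul1r) oner_eq0.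
  + by rewrite /M /diag3 ?(cof3E, mx3_simpl); apply: mx3_eq; field; rewrite ?r0 ?h0.
  + by rewrite /diag3 ?(cof3E, mx3_simpl); apply: mx3_eq; field.
apply: (isometric_classified iso).
  exact: (classify_rank1_M1 h0 (nilsoliton_transport iso nil)).
Qed.

Lemma classify_rank1 S M (c : bool) gamma :
  nilsoliton (metric S M (diag3 0 0 ((-1) ^+ c))) gamma ->
  classified (metric S M (diag3 0 0 ((-1) ^+ c))) gamma.
Proof.
have [p [q [m13 [r [s [m23 [u [v [m33 ->]]]]]]]]] := mx3P M.
move=> nil; have g0 := nilsoliton_degenerate nil; rewrite {}g0 in nil *.
have h0 : (-1) ^+ c != 0 :> R by rewrite signr_eq0.
have [S' iso] := rank1_kill_column S p q m13 r s m23 u v m33 h0.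
apply: (isometric_classified iso); have {iso}nil := nilsoliton_transport iso nil.
move: S' nil => {}S nil.
(* The common annihilator of the two columns is spanned by their cross product [n]. *)
pose n1 := r * v - u * s; pose n2 := u * q - p * v; pose n3 := p * s - r * q.
have move_n f1 f2 : f1 * n2 - f2 * n1 != 0 ->
    classified (metric S (mx3 [:: [:: p; q; 0]; [:: r; s; 0]; [:: u; v; 0]])
     (diag3 0 0 ((-1) ^+ c))) 0.
  (* The annihilator [n] becomes the new [e_2]. Keeping [e_3] as last column means that [E] is only
     rescaled. *)
  move=> f0; pose B := mx3 [:: [:: f1; n1; 0]; [:: f2; n2; 0]; [:: 0; n3; 1]].
  have uB : B \in unitmx.
    apply: unitmx3; rewrite !(mulr0, mul0r, addr0, subr0, mulr1).
    by have -> : f1 * n2 + n1 * (0 - f2) = f1 * n2 - f2 * n1 by ring.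
  have h'0 : (-1) ^+ c * (f1 * n2 - f2 * n1) ^+ 2 != 0 by rewrite mulf_neq0 // sqrf_eq0.
  have [S' [a1 [a2 [a3 [b3 [c1 [c2 [c3 iso]]]]]]]] : exists S' a1 a2 a3 b3 c1 c2 c3, isometric
      (metric S (mx3 [:: [:: p; q; 0]; [:: r; s; 0]; [:: u; v; 0]]) (diag3 0 0 ((-1) ^+ c)))
      (metric S' (mx3 [:: [:: a1; a2; a3]; [:: 0; 0; b3]; [:: c1; c2; c3]])
        (diag3 0 0 ((-1) ^+ c * (f1 * n2 - f2 * n1) ^+ 2))).
    do 8!eexists; apply: (@isometric_transform R B 0 _ _ _ _ _ _ uB);
      [reflexivity| | |by mx3_ring].
    + rewrite /B /n1 /n2 /n3 /diag3 ?(cof3E, mx3_simpl); apply: mx3_eq; try reflexivity; by ring.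
    + by rewrite /B /n1 /n2 /n3; mx3_ring.
  apply: (isometric_classified iso); have {iso}nil' := nilsoliton_transport iso nil.
  have [S'' iso] := rank1_kill_column S' a1 a2 a3 0 0 b3 c1 c2 c3 h'0.
  apply: (isometric_classified iso).
  exact: (classify_rank1_row h'0 (nilsoliton_transport iso nil')).
have [n10|n10] := eqVneq n1 0; last first.
  by apply: (move_n 0 1); rewrite mul0r mul1r sub0r oppr_eq0.
have [n20|n20] := eqVneq n2 0; last first.
  by apply: (move_n 1 0); rewrite mul0r mul1r subr0.
have n30 : n3 != 0 by apply/eqP => n30; exact: (rank1_columns nil n10 n20 n30).
(* [n] is orthogonal to both columns, so once it lies on the third axis their third entries
   vanish. *)
have u0 : u = 0.
  apply/eqP; rewrite -(mulIr_eq0 _ (mulIf n30)); apply/eqP.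
  transitivity (- (p * n1 + r * n2)); first by rewrite /n1 /n2 /n3; ring.
  by rewrite n10 n20 !mulr0 addr0 oppr0.
have v0 : v = 0.
  apply/eqP; rewrite -(mulIr_eq0 _ (mulIf n30)); apply/eqP.
  transitivity (- (q * n1 + s * n2)); first by rewrite /n1 /n2 /n3; ring.
  by rewrite n10 n20 !mulr0 addr0 oppr0.
by move: nil; rewrite u0 v0; exact: classify_rank1_flat.
Qed.

Lemma nilsoliton_classified (g : 'M[R]_6) gamma : nilsoliton g gamma -> classified g gamma.
Proof.
move=> nil; have [[gT _] _] := nil.
have gE : g = metric (ulsubmx (g : 'M_(3 + 3))) (ursubmx (g : 'M_(3 + 3)))
                     (drsubmx (g : 'M_(3 + 3))).
  by rewrite /metric trmx_ursub gT submxK.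
have ET : (drsubmx (g : 'M_(3 + 3)))^T = drsubmx (g : 'M_(3 + 3)).
  by rewrite trmx_drsub gT.
move: nil gE ET; move: (ulsubmx _) (ursubmx _) (drsubmx _) => S M E nil gE ET.
have [E' EE can] := sym_canonical_ctr ET.
have ET' : E'^T = E'.
  by case: can => [[a [c [_ _ ->]]]|[a _ ->]|[->|[a _ ->]]|->]; mx3_ring.
have [S' [M' iso]] := congruent_isometric S M EE ET'.
rewrite -gE in iso; apply: (isometric_classified iso).
have {iso EE ET ET'}nil := nilsoliton_transport iso nil.
have sgn (a : R) : a = 1 \/ a = -1 -> exists b : bool, a = (-1) ^+ b.
  by case=> ->; [exists false|exists true].
case: can nil => [[a [c [a1 c1 ->]]]|[a a1 ->]|[->|[a a1 ->]]|->] nil.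
- exact: classify_scaled.
- have [b bE] := sgn a a1; rewrite {}bE in nil *.
  have g0 := nilsoliton_degenerate nil; rewrite {}g0 in nil *.
  have [x [y [z iso]]] := rank2_reduce (sqrr_sign _ b) (sqrr_sign _ b) nil.
  apply: (isometric_classified iso); apply: classify_definite.
  exact: nilsoliton_transport iso nil.
- have g0 := nilsoliton_degenerate nil; rewrite {}g0 in nil *.
  have m1 : (-1) ^+ 2 = 1 :> R by rewrite sqrrN expr1n.
  have [x [y [z iso]]] := rank2_reduce (expr1n _ 2) m1 nil.
  apply: (isometric_classified iso); apply: classify_indefinite.
  exact: nilsoliton_transport iso nil.
- by have [b bE] := sgn a a1; rewrite {}bE in nil *; exact: classify_rank1.
- exact: classify_rank0.
Qed.

(** * The listed families are nilsolitons *)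

Lemma family_i_nilsoliton (h : 'M[R]_6) gamma : family_i h gamma -> nilsoliton h gamma.
Proof.
case=> l l0; have := nilsoliton_scaled l0 (expr1n _ 2) (expr1n _ 2).
by rewrite !mulr1.
Qed.

Lemma family_ii_nilsoliton (h : 'M[R]_6) gamma : family_ii h gamma -> nilsoliton h gamma.
Proof.
have m1 : (-1) ^+ 2 = 1 :> R by rewrite sqrrN expr1n.
case=> l l0; have := nilsoliton_scaled l0 m1 (expr1n _ 2).
by rewrite !(mulr1, mulrN, mulNr, opprK).
Qed.

Lemma family_iii_nilsoliton (h : 'M[R]_6) gamma : family_iii h gamma -> nilsoliton h gamma.
Proof.
have zE (z : R) : z *: E10 R = diag3 0 0 z by rewrite /E10; mx3_ring.
case=> [b x z x0 z0|x z x0 z0|x x0|z z0|b c l l0].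
- have -> : (-1) ^+ b *: E20 R = diag3 0 ((-1) ^+ b) ((-1) ^+ b) by rewrite /E20; mx3_ring.
  apply: nilsoliton_rank2; rewrite ?signr_eq0 // expr0n subr0; exact: mulf_neq0.
- by apply: nilsoliton_rank2; rewrite ?oppr_eq0 ?oner_eq0 // expr0n subr0 mulf_neq0.
- apply: nilsoliton_rank2; rewrite ?oppr_eq0 ?oner_eq0 // mulr0 sub0r oppr_eq0 sqrf_eq0.
  by rewrite mulf_neq0 ?normr_eq0 ?invr_eq0 ?pnatr_eq0.
- apply: nilsoliton_rank2; rewrite ?oppr_eq0 ?oner_eq0 // mul0r sub0r oppr_eq0 sqrf_eq0.
  by rewrite mulf_neq0 ?normr_eq0 ?invr_eq0 ?pnatr_eq0.
- rewrite !zE; apply: isometric_nilsoliton (isometric_M1 _ _ _) _; rewrite ?signr_eq0 //.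
  by apply: nilsoliton_rank1; rewrite ?signr_eq0 // mulr0 mulr1 sub0r oppr_eq0.
Qed.

Lemma omitted_nilsoliton (h : 'M[R]_6) gamma : omitted_family h gamma -> nilsoliton h gamma.
Proof.
have m1 : (-1) ^+ 2 = 1 :> R by rewrite sqrrN expr1n.
have zE (z : R) : z *: E10 R = diag3 0 0 z by rewrite /E10; mx3_ring.
case=> [l l0|l l0|a b b0|b c l l0|b c p q r s d0|M uM].
- have := nilsoliton_scaled l0 (expr1n _ 2) m1.
  have -> : - E30 R = diag3 (-1) (-1) (-1) by rewrite /E30; mx3_ring.
  by rewrite !(mulr1, mul1r, mulrN, mulNr, opprK).
- have := nilsoliton_scaled l0 m1 m1.
  have -> : - E21 R = diag3 (-1) (-1) 1 by rewrite /E21; mx3_ring.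
  by rewrite !(mulr1, mul1r, mulrN, mulNr, opprK).
- apply: nilsoliton_rank2; rewrite ?oppr_eq0 ?oner_eq0 // mulrN -opprD oppr_eq0.
  by rewrite -expr2 gt_eqF // ltr_wpDl ?sqr_ge0 // lt0r sqrf_eq0 b0 sqr_ge0.
- rewrite zE; have -> : (-1) ^+ b *: diag3 0 1 0 = diag3 0 ((-1) ^+ b) 0 :> 'M[R]_3 by mx3_ring.
  by apply: nilsoliton_rank1; rewrite ?signr_eq0 // mul1r mulr0 subr0.
- by rewrite !zE; apply: nilsoliton_rank1_flat; rewrite ?signr_eq0.
- exact: nilsoliton_rank0.
Qed.

End LowRank.

Theorem proposition4p6 (R : realType) :
  [/\ forall (h : 'M[R]_6) (gamma : R), family_i h gamma -> expanding h gamma,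
      forall (h : 'M[R]_6) (gamma : R), family_ii h gamma -> shrinking h gamma,
      forall (h : 'M[R]_6) (gamma : R), family_iii h gamma -> steady h gamma
    & forall (g : 'M[R]_6) (gamma : R),
        nilsoliton g gamma <->
        exists2 h : 'M[R]_6,
          [\/ family_i h gamma, family_ii h gamma, family_iii h gamma
            | omitted_family h gamma]
          & isometric g h].
Proof.
have pos (l : R) : l != 0 -> 0 < 5 / (2 * l ^+ 2).
  by move=> l0; rewrite divr_gt0 ?ltr0n // mulr_gt0 ?ltr0n // lt0r sqrf_eq0 l0 sqr_ge0.
split=> [h gamma fh|h gamma fh|h gamma fh|g gamma].
- split; first exact: family_i_nilsoliton.
  by case: fh => l l0; rewrite oppr_lt0 pos.
- by split; [exact: family_ii_nilsoliton|case: fh => l l0; exact: pos].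
- by split; [exact: family_iii_nilsoliton|case: fh].
split=> [|[h fh gh]]; first exact: nilsoliton_classified.
apply: isometric_nilsoliton gh _.
case: fh; [exact: family_i_nilsoliton|exact: family_ii_nilsoliton
  |exact: family_iii_nilsoliton|exact: omitted_nilsoliton].
Qed.
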